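(* Let $p\ge1$, let $u\in l^p(\mathbb{Z}^d)$ be nonnegative, and let $u^*=R_{\mathbb{Z}^d}u$. Then $$\|\nabla u^*\|_p\le\|\nabla u\|_p.$$ Moreover, if $p>1$ and $\operatorname{ran}(u)=[a_1>a_2>\cdots]$, then equality holds if and only if $u\cong u^*$.
   Context: $\mathbb{R}_+=[0,\infty)$, $d\ge1$ is an integer, $e_i$ is the $i$-th standard unit vector, $\langle\cdot,\cdot\rangle$ the Euclidean inner product. $\mathbb{Z}^d$ is the lattice graph: $x\sim y$ iff $x-y=\pm e_i$ for some $i$. $\|\nabla u\|_p^p=\frac12\sum_{x}\sum_{y\sim x}|u(x)-u(y)|^p$; $l^p(\mathbb{Z}^d)$ is the set of $u:\mathbb{Z}^d\to\mathbb{R}$ with $\sum_x|u(x)|^p<\infty$ ($1\le p<\infty$). $u_1\cong u_2$ means that there is a graph automorphism $\sigma$ of $\mathbb{Z}^d$ (a bijection with $x\sim y\Leftrightarrow\sigma(x)\sim\sigma(y)$) such that $u_1(\sigma(x))=u_2(x)$ for all $x$. Admissible functions: $u\in C_0^+(\mathbb{Z}^d)$ means $u:\mathbb{Z}^d\to\mathbb{R}_+$ with $\{u>t\}$ finite for all $t>0$ (similarly on $\mathbb{Z}$ or $\mathbb{Z}+1/2$). The $n$-th largest value of $u$ is $a_n=\sup_{|\Omega|=n}\min_{\Omega}u$, $n\ge1$; $\operatorname{ran}(u)=[a_1>a_2>\cdots]$ means that $a_n>a_{n+1}$ for all $n\ge1$. One-dimensional rearrangement: for $w$ admissible on $\mathbb{Z}$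 or on $\mathbb{Z}+1/2$ with largest values $a_1\ge a_2\ge\cdots$ (with multiplicity), $R_{\mathbb{Z}}w(x)=a_{1-2x}$ if $x\le0$ and $R_{\mathbb{Z}}w(x)=a_{2x}$ if $x>0$. Rearrangement on $\mathbb{Z}^d$: let $\vec E=\{e_i,\frac{e_i+e_j}{2},\frac{e_i-e_j}{2}:1\le i<j\le d\}$ (all $e_i$, $1\le i\le d$, included). For $e\in\vec E$, partition $\mathbb{Z}^d$ into the classes of the relation ''$x-y$ is parallel to $e$''; on each class $V$ the map $x\mapsto\langle e,x\rangle$ is a bijection onto $\mathbb{Z}$ or $\mathbb{Z}+1/2$, and the one-step rearrangement $R_eu$ is defined by $(R_eu)|_V=R_{\mathbb{Z}}(u|_V)$ under this identification. Fix an enumeration of $\vec E$ (for $d=2$: $e_1,e_2,\frac{e_1+e_2}{2},\frac{e_1-e_2}{2}$); $R^ku$ is obtained from $u$ by applying successively the first $k$ of the operators $R_e$ in the sequence obtained by repeating this enumeration cyclically. The Schwarz rearrangement is $R_{\mathbb{Z}^d}u(x)=\lim_{k\to\infty}R^ku(x)$, $x\in\mathbb{Z}^d$ (the limit exists). *)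

(* Defs.v *)
From mathcomp Require Import all_boot all_order all_algebra.
From mathcomp Require Import all_classical all_reals all_analysis.

Set Implicit Arguments.
Unset Strict Implicit.
Unset Printing Implicit Defensive.

Import Order.TTheory GRing.Theory Num.Theory.
Import numFieldNormedType.Exports.

Local Open Scope classical_set_scope.
Local Open Scope ring_scope.

(* Z^d is 'rV[int]_d; the index i of e_i runs over 'I_d, hence is 0-based. *)
Definition adj (d : nat) (x y : 'rV[int]_d) : Prop :=
  exists i : 'I_d, x - y = delta_mx 0 i \/ x - y = - delta_mx 0 i.

(* u1 and u2 agree up to a graph automorphism of Z^d. *)
Definition lattice_iso (R : realType) (d : nat) (u1 u2 : 'rV[int]_d -> R) : Prop :=
  exists sigma : 'rV[int]_d -> 'rV[int]_d,
    [/\ bijective sigma,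
        forall x y, adj x y <-> adj (sigma x) (sigma y)
      & forall x, u1 (sigma x) = u2 x].

Definition in_lp (R : realType) (d : nat) (p : R) (u : 'rV[int]_d -> R) : Prop :=
  (\esum_(x in [set: 'rV[int]_d]) (`|u x| `^ p)%:E < +oo)%E.

(* Extended-real valued, so that it makes sense for arbitrary u. *)
Definition grad_norm (R : realType) (d : nat) (p : R) (u : 'rV[int]_d -> R) : \bar R :=
  poweR ((2^-1)%:E *
         \esum_(x in [set: 'rV[int]_d])
           \esum_(y in [set y | adj y x]) (`|u x - u y| `^ p)%:E)%E p^-1.

(* n-th largest value of the restriction of w to D, counted with multiplicity
   from n = 1: the supremum over the n-element subsets O of D of min_O w; the
   minimum over a nonempty finite set is written as an infimum. *)
Definition nth_largest (R : realType) (T : Type) (D : set T) (w : T -> R) (n : nat) : R :=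
  sup [set inf (w @` O) | O in [set O : set T | O `<=` D /\ (O #= `I_n)%card]].

Definition strict_range (R : realType) (d : nat) (u : 'rV[int]_d -> R) : Prop :=
  forall n : nat, (1 <= n)%N ->
    nth_largest setT u n.+1 < nth_largest setT u n.

(* The one-dimensional rearrangement of w : D -> R, where D is Z or Z + 1/2 as
   a subset of rat. For t in D, both 1 - 2t (if t <= 0) and 2t (if t > 0) are
   positive integers, which truncn merely casts to nat. *)
Definition RZ (R : realType) (D : set rat) (w : rat -> R) (t : rat) : R :=
  nth_largest D w (if t <= 0 then Num.truncn (1 - 2 * t) else Num.truncn (2 * t)).

Definition inner (d : nat) (e : 'rV[rat]_d) (x : 'rV[int]_d) : rat :=
  \sum_(i < d) e 0 i * (x 0 i)%:~R.

Definition Edir (d : nat) : set 'rV[rat]_d :=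
  [set e | (exists i : 'I_d, e = delta_mx 0 i) \/
           (exists i j : 'I_d, (i < j)%N /\
              (e = 2^-1 *: (delta_mx 0 i + delta_mx 0 j) \/
               e = 2^-1 *: (delta_mx 0 i - delta_mx 0 j)))].

Definition enumerates_Edir (d : nat) (s : seq 'rV[rat]_d) : Prop :=
  uniq s /\ [set` s] = @Edir d.

(* The points y such that x - y is parallel to e. *)
Definition line (d : nat) (e : 'rV[rat]_d) (x : 'rV[int]_d) : set 'rV[int]_d :=
  [set y | exists c : rat, map_mx intr (x - y) = c *: e].

(* On V := line e x, the map inner e is injective with image Z or Z + 1/2;
   'pinv_ is its inverse there. *)
Definition Rstep (R : realType) (d : nat) (e : 'rV[rat]_d) (u : 'rV[int]_d -> R)
    (x : 'rV[int]_d) : R :=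
  let V := line e x in
  RZ (inner e @` V) (u \o 'pinv_(fun=> 0) V (inner e)) (inner e x).

(* R^k: the first k operators of the cyclic repetition of the enumeration s. *)
Fixpoint Riter (R : realType) (d : nat) (s : seq 'rV[rat]_d) (k : nat)
    (u : 'rV[int]_d -> R) : 'rV[int]_d -> R :=
  if k is k'.+1 then Rstep (nth 0 s (k' %% size s)%N) (Riter s k' u) else u.

Definition schwarz (R : realType) (d : nat) (s : seq 'rV[rat]_d)
    (u : 'rV[int]_d -> R) (x : 'rV[int]_d) : R :=
  limn (fun k : nat => Riter s k u x).

(* Main.v *)
Require Import Defs.
From mathcomp Require Import all_boot all_order all_algebra.
From mathcomp Require Import all_classical all_reals all_analysis.
From mathcomp Require Import finmap ring lra zify.

Set Implicit Arguments.
Unset Strict Implicit.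
Unset Printing Implicit Defensive.

Import Order.TTheory GRing.Theory Num.Theory.
Import numFieldNormedType.Exports.
Local Open Scope classical_set_scope.
Local Open Scope ring_scope.

(** The energy, the sum of [`|u x - u y| `^ p] over the edges, already decreases
    under a much simpler symmetrization than the one-step rearrangements. The lines
    of a direction in [Edir] come with mirrors: hyperplanes orthogonal to the
    direction, whose reflections are automorphisms of the lattice graph. Polarizing
    [u] with respect to a mirror puts, in each pair of mirror images, the larger
    value at the point that comes first in the order 0, 1, -1, 2, -2, ... (or 1/2,
    -1/2, 3/2, ...) of its line. An edge that meets a mirror has an endpoint on it or
    joins two mirror images, so an edge and its image form a configuration to which
    the exchange inequality for convex functions applies, and summing over such
    pairs shows that the energy does not increase ([polarization_energy]).

    Polarizations generate everything else through limits. There is a weight on the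
    lattice, a squared distance to a point slightly off the origin, that is ordered
    along every line of every direction as the places on that line are. Hence a
    polarization changes a superlevel set only by lowering its total weight, a
    natural number. It follows that above any positive threshold a sequence of
    polarizations is eventually stationary ([improves_limit]). If it uses every
    mirror of one direction infinitely often, its limit is sorted on each line, and
    it has the same number of values above each positive level there, so it is the
    one-step rearrangement ([nth_largest_lattice_line]). The same convergence result,
    applied to the one-step rearrangements, shows that the limit defining the Schwarz
    rearrangement exists. Energy passes to these limits by lower semicontinuity, which
    gives the inequality. All that is inherited in this way is recorded in the
    relation [improves].

    Suppose now that [1 < p], that no energy is lost, and that the positive values of
    [u] are distinct and infinitely many. Every polarization used along the way
    then preserves the energy, and strict convexity forces it to keep unchanged the
    set of pairs of positive values that occupy adjacent points
    ([polarization_rigid], [polarization_adj_values]); so do the limits. The Schwarz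
    rearrangement is positive everywhere ([schwarz_gt0]): its support is infinite and
    closed under the moves that bring a point closer to the centre along a line.
    Mapping [x] to the point where [u] takes the value of its rearrangement at [x]
    is thus an embedding of the lattice onto an induced subgraph. All degrees being
    equal to [2 * d], its image is closed under adjacency, and it is a graph
    automorphism ([adj_values_iso]). Conversely, automorphisms preserve the energy. *)

(** * Convexity of the p-th power *)

Section Power.
Variable R : realType.
Implicit Types a b l m p s w x y z : R.

(** The logarithm lies strictly below its tangent: applied to [A / m] and [1 / m],
    where [A = s `^ p] and [m] is the mean of [A] and [1] with weights [1 / p] and
    [1 - 1 / p], this gives [s < m], which is the claim divided by [p]. *)
Lemma bernoulli_lt p s : 1 < p -> 0 <= s -> s != 1 -> 1 + p * (s - 1) < s `^ p.
Proof.
move=> p1 s0 s1; have p0 : 0 < p by lra.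
case: (eqVneq s 0) => [->|sn0].
  by rewrite powR0 ?gt_eqF//; lra.
have sp : 0 < s by rewrite lt_neqAle eq_sym sn0.
set A := s `^ p; have Ap : 0 < A by rewrite powR_gt0.
rewrite -subr_gt0; case: (leP (1 + p * (s - 1)) 0) => [h|h]; first by lra.
rewrite subr_gt0.
have lnA : ln A = p * ln s by rewrite ln_powR.
have tg y : 0 < y -> y != 1 -> ln y < y - 1.
  move=> y0 y1; have l0 : ln y != 0.
    by apply: contra y1 => /eqP h1; rewrite -(lnK y0) h1 expR0.
  by have := expR_gt1Dx l0; rewrite lnK//; lra.
have tgw y : 0 < y -> ln y <= y - 1.
  by move=> y0; case: (eqVneq y 1) => [->|/(tg _ y0)/ltW//]; rewrite ln1 subrr.
set m := (A + p - 1) / p.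
have m0 : 0 < m by rewrite divr_gt0//; lra.
suff : s < m by rewrite /m ltr_pdivlMr//; lra.
rewrite -ltr_ln ?posrE//.
have iv : 0 < m^-1 by rewrite invr_gt0.
have A1 : A != 1 by rewrite powR_eq1 !negb_or s1 -leNgt s0 gt_eqF.
have h1 : ln (A / m) <= A / m - 1 by apply: tgw; rewrite divr_gt0.
have h2 : ln (m^-1) <= m^-1 - 1 by apply: tgw.
have m1 : m^-1 != 1.
  rewrite invr_eq1; apply: contra A1 => /eqP h3; apply/eqP.
  have : m * p = A + p - 1 by rewrite /m divfK// gt_eqF.
  by rewrite h3; lra.
have h2' := tg _ iv m1.
rewrite ln_div ?posrE// lnA in h1.
rewrite lnV ?posrE// in h2'.
have e : A / m + (p - 1) * m^-1 = p.
  by rewrite -mulrDl addrA /m invf_div mulrCA divff ?mulr1// gt_eqF//; lra.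
have h3 : (p - 1) * - ln m < (p - 1) * (m^-1 - 1) by rewrite ltr_pM2l//; lra.
rewrite -(ltr_pM2l p0); nra.
Qed.

Lemma bernoulli_le p s : 1 <= p -> 0 <= s -> 1 + p * (s - 1) <= s `^ p.
Proof.
rewrite le_eqVlt => /predU1P[<-|p1] s0; first by rewrite powRr1//; lra.
case: (eqVneq s 1) => [->|s1]; first by rewrite subrr mulr0 addr0 powR1.
exact/ltW/bernoulli_lt.
Qed.

(** The left-hand side is the tangent at [m] of the function [x `^ p], evaluated at
    [x]; the inequality is Bernoulli's for [x / m]. *)
Lemma powR_tangent p m x : 1 <= p -> 0 < m -> 0 <= x ->
  m `^ p * (1 + p * (x / m - 1)) <= x `^ p ?= iff (p == 1) || (x == m).
Proof.
move=> p1 m0 x0; have xm : 0 <= x / m by rewrite divr_ge0// ltW.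
have mp : 0 < m `^ p by rewrite powR_gt0.
have e : x `^ p = m `^ p * (x / m) `^ p.
  by rewrite -powRM// 1?ltW// mulrCA divff ?gt_eqF// mulr1.
rewrite e; split; first by rewrite ler_pM2l// bernoulli_le.
have -> : (x == m) = (x / m == 1).
  apply/eqP/eqP => [->|h]; first by rewrite divff// gt_eqF.
  by rewrite -[LHS](divfK (lt0r_neq0 m0)) [_ / _]h; exact: mul1r.
apply/idP/idP => [|/orP[/eqP->|/eqP->]]; last 2 first.
- by rewrite !powRr1 ?(ltW m0)// mul1r addrC subrK.
- by rewrite subrr mulr0 addr0 powR1.
rewrite (inj_eq (mulfI (lt0r_neq0 mp))) => h; apply/negPn; rewrite negb_or.
apply/negP => /andP[pn1 sn1]; move: h; apply/negP; rewrite lt_eqF// bernoulli_lt//.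
by rewrite lt_neqAle eq_sym pn1.
Qed.

(** Compare with the tangent of the power at the mean [m] of [`|x|] and [`|w|].
    Strictness comes from the tangent unless [`|x| = `|w|], and then from the
    triangle inequality, because [x] and [w] have opposite signs. *)
Lemma normr_powR_convex p l x w : 1 <= p -> 0 < l < 1 ->
  `|l * x + (1 - l) * w| `^ p <= l * `|x| `^ p + (1 - l) * `|w| `^ p
  /\ (1 < p -> x != w ->
  `|l * x + (1 - l) * w| `^ p < l * `|x| `^ p + (1 - l) * `|w| `^ p).
Proof.
move=> p1 /andP[l0 l1]; have p0 : 0 < p by lra.
set m := l * `|x| + (1 - l) * `|w|.
have ym : `|l * x + (1 - l) * w| <= m.
  rewrite (le_trans (ler_normD _ _))// !normrM (gtr0_norm l0) (@gtr0_norm _ (1 - l))//.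
  lra.
have [/eqP m0|mn0] := eqVneq m 0.
  have [] : `|x| = 0 /\ `|w| = 0.
    have := normr_ge0 x; have := normr_ge0 w; move: m0 => /eqP; rewrite /m; nra.
  move=> /eqP; rewrite normr_eq0 => /eqP -> /eqP; rewrite normr_eq0 => /eqP ->.
  rewrite eqxx; split=> //.
  by rewrite !mulr0 addr0 normr0 powR0 ?gt_eqF// !mulr0 addr0.
have m0 : 0 < m.
  rewrite lt_neqAle eq_sym mn0 /=; exact: le_trans ym.
have [tx txe] := powR_tangent p1 m0 (normr_ge0 x).
have [tw twe] := powR_tangent p1 m0 (normr_ge0 w).
have ymp : `|l * x + (1 - l) * w| `^ p <= m `^ p.
  by rewrite ge0_ler_powR ?nnegrE// ltW.
have e : l * (m `^ p * (1 + p * (`|x| / m - 1))) +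
  (1 - l) * (m `^ p * (1 + p * (`|w| / m - 1))) = m `^ p.
  have h : l * (`|x| / m) + (1 - l) * (`|w| / m) = 1.
    by rewrite !mulrA -mulrDl -/m divff.
  set X := `|x| / m in h *; set W := `|w| / m in h *; set q := m `^ p.
  transitivity (q * (1 - p) + q * p * (l * X + (1 - l) * W)); first by ring.
  by rewrite h; ring.
have c1 : 0 < 1 - l by lra.
split.
  rewrite (le_trans ymp)// -e lerD// ler_pM2l//.
move=> pgt xw; have pn : (p == 1) = false by rewrite gt_eqF.
rewrite pn /= in txe twe.
case: (eqVneq `|x| m) => [xm|xm].
  case: (eqVneq `|w| m) => [wm|wm].
    have -> : l * `|x| `^ p + (1 - l) * `|w| `^ p = m `^ p by rewrite xm wm; ring.
    rewrite gt0_ltr_powR ?nnegrE ?normr_ge0//; first exact: ltW.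
    move: xm wm; rewrite lt_neqAle ym andbT.
    case: (ger0P x) => _ xm; case: (ger0P w) => _ wm.
    - by move: xw; rewrite xm wm eqxx.
    - have -> : w = - m by lra.
      rewrite xm; case: ger0P => _; apply/eqP; nra.
    - have -> : x = - m by lra.
      rewrite wm; case: ger0P => _; apply/eqP; nra.
    - by move: xw; rewrite (_ : x = w) ?eqxx//; lra.
  rewrite (le_lt_trans ymp)// -e; apply: ler_ltD; first by rewrite ler_pM2l.
  by rewrite ltr_pM2l// lt_neqAle tw twe wm.
rewrite (le_lt_trans ymp)// -e; apply: ltr_leD; last by rewrite ler_pM2l.
by rewrite ltr_pM2l// lt_neqAle tx txe xm.
Qed.

(** The four differences satisfy [(a - b') + (a' - b) = (a - b) + (a' - b')], and the
    two on the left lie between the two on the right, so convexity compares the sums: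
    matching large with large and small with small is cheapest. *)
Lemma exchange_powR p a a' b b' : 1 <= p -> a' <= a -> b <= b' ->
  `|a - b'| `^ p + `|a' - b| `^ p <= `|a - b| `^ p + `|a' - b'| `^ p
  /\ (1 < p -> a' < a -> b < b' ->
  `|a - b'| `^ p + `|a' - b| `^ p < `|a - b| `^ p + `|a' - b'| `^ p).
Proof.
move=> p1; rewrite le_eqVlt => /predU1P[->|aa].
  by move=> _; split=> [|_]; rewrite ?ltxx// addrC.
rewrite le_eqVlt => /predU1P[->|bb]; first by split=> // _ _; rewrite ltxx.
set x := a' - b'; set w := a - b.
have D : 0 < w - x by rewrite /w /x; lra.
(* [a - b'] is the convex combination of [x] and [w] with weight [l] on [x]. *)
pose l := (b' - b) / (w - x).
have l01 : 0 < l < 1.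
  by apply/andP; split; rewrite /l ?divr_gt0 ?ltr_pdivrMr// /w /x; lra.
have l01' : 0 < 1 - l < 1 by lra.
have e0 : l * (w - x) = b' - b by rewrite /l divfK// gt_eqF.
have e1 : a - b' = l * x + (1 - l) * w.
  by transitivity (w - l * (w - x)); [rewrite e0 /w|]; ring.
have e2 : a' - b = (1 - l) * x + (1 - (1 - l)) * w.
  by transitivity (x + l * (w - x)); [rewrite e0 /x|]; ring.
have [c1 s1] := normr_powR_convex x w p1 l01.
have [c2 s2] := normr_powR_convex x w p1 l01'.
rewrite e1 e2; split; first by lra.
move=> pgt _ _; have xw : x != w by rewrite lt_eqF//; lra.
by have := s1 pgt xw; have := s2 pgt xw; lra.
Qed.

End Power.

(** * The lattice graph and its automorphisms *)

Section Lattice.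
Variable d : nat.
Local Notation T := 'rV[int]_d.
Implicit Types x y z : T.

Definition unitv (i : 'I_d) : T := delta_mx 0 i.

Definition nbrs x : seq T :=
  [seq x + unitv i | i <- enum 'I_d] ++ [seq x - unitv i | i <- enum 'I_d].

Lemma unitvE i j : unitv i 0 j = (i == j)%:R.
Proof. by rewrite mxE eqxx /= eq_sym. Qed.

Lemma unitv_inj : injective unitv.
Proof.
move=> i j /rowP/(_ i); rewrite !unitvE eqxx.
by case: (eqVneq j i) => [->|].
Qed.

Lemma nbrsP x y : reflect (adj y x) (y \in nbrs x).
Proof.
apply: (iffP idP) => [|[i [] h]]; rewrite mem_cat.
- move=> /orP[] /mapP[i _ ->]; exists i; [left|right].
  + by rewrite addrC addKr.
  + by rewrite addrC addKr.
- by apply/orP; left; apply/mapP; exists i; rewrite ?mem_enum// /unitv -h addrC subrK.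
- by apply/orP; right; apply/mapP; exists i; rewrite ?mem_enum// /unitv -h addrC subrK.
Qed.

Lemma adj_sym x y : adj x y -> adj y x.
Proof.
by case=> i [] h; exists i; [right|left]; rewrite -opprB h ?opprK.
Qed.

Lemma nbrs_uniq x : uniq (nbrs x).
Proof.
rewrite cat_uniq; apply/and3P; split.
- by rewrite map_inj_uniq ?enum_uniq// => i j /addrI/unitv_inj.
- apply/hasPn => y /mapP[i _ ->]; apply/negP => /mapP[j _ /addrI/rowP/(_ i)].
  by rewrite mxE !unitvE eqxx; case: (j == i).
- by rewrite map_inj_uniq ?enum_uniq// => i j /addrI/oppr_inj/unitv_inj.
Qed.

Lemma size_nbrs x : size (nbrs x) = (d + d)%N.
Proof. by rewrite size_cat !size_map -enumT size_enum_ord. Qed.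

(** The lattice is connected, phrased as an induction principle along edges. *)
Lemma adj_connected (Q : T -> Prop) x z :
  Q x -> (forall y y', Q y -> adj y y' -> Q y') -> Q z.
Proof.
move=> Qx Qadj.
have step i (k : int) y : Q y -> Q (y + k *: unitv i).
  have up (n : nat) y' : Q y' -> Q (y' + n%:Z *: unitv i).
    elim: n y' => [|n IH] y' Qy; first by rewrite scale0r addr0.
    rewrite intS scalerDl scale1r addrA; apply/IH/(Qadj _ _ Qy).
    by exists i; right; rewrite opprD addrA subrr add0r.
  have dn (n : nat) y' : Q y' -> Q (y' - n%:Z *: unitv i).
    elim: n y' => [|n IH] y' Qy; first by rewrite scale0r subr0.
    rewrite intS scalerDl scale1r opprD addrA; apply/IH/(Qadj _ _ Qy).
    by exists i; left; rewrite opprB addrCA subrr addr0.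
  by case: (intP k) => [|n|n] Qy; [rewrite scale0r addr0|exact: up|rewrite scaleNr; exact: dn].
rewrite -(subrK x z) addrC [X in x + X]row_sum_delta.
move: x Qx {z}(z - x) => x Qx z; move: x Qx.
apply: (big_ind (fun s => forall x, Q x -> Q (x + s))) => [x Qx|s1 s2 h1 h2 x Qx|i _ x Qx].
- by rewrite addr0.
- by rewrite addrA; apply/h2/h1.
- exact: step.
Qed.

Definition automorphism (g : T -> T) : Prop :=
  bijective g /\ forall x y, adj x y <-> adj (g x) (g y).

Lemma perm_nbrs_automorphism g x : automorphism g ->
  perm_eq (nbrs (g x)) [seq g y | y <- nbrs x].
Proof.
move=> [gb ga]; apply: uniq_perm; first exact: nbrs_uniq.
  by rewrite map_inj_uniq ?nbrs_uniq//; exact: bij_inj gb.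
move=> y; apply/nbrsP/mapP => [|[z /nbrsP yz ->]]; last exact: (ga _ _).1.
have [g' gg' g'g] := gb.
by rewrite -(g'g y) => /((ga _ _).2) h; exists (g' y) => //; apply/nbrsP.
Qed.

End Lattice.

(** * The p-energy *)

Section ExtendedSums.
Variable R : realType.

Lemma esum_seqE (T' : choiceType) (s : seq T') (f : T' -> R) : uniq s ->
  (forall x, 0 <= f x) ->
  \esum_(y in [set` s]) (f y)%:E = (\sum_(y <- s) f y)%:E.
Proof.
move=> us f0; rewrite esum_fset; first by rewrite -fsbig_seq// sumEFin.
- exact: finite_seq.
- by move=> i _; rewrite lee_fin.
Qed.

Lemma addee_le (a b : \bar R) : (0 <= a)%E -> (0 <= b)%E ->
  (a + a <= b + b)%E -> (a <= b)%E.
Proof.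
case: a b => [a||] [b||]//=; rewrite ?leey ?lee_fin// => a0 b0 h; lra.
Qed.

(** A nonnegative family with a finite sum cannot be enlarged at a single point
    without enlarging the sum; this turns equality of energies into equality edge by
    edge. *)
Lemma esum_le_eq (T' : choiceType) (f g : T' -> R) :
  (forall x, 0 <= f x) -> (forall x, f x <= g x) ->
  (\esum_(x in [set: T']) (g x)%:E < +oo)%E ->
  (\esum_(x in [set: T']) (g x)%:E <= \esum_(x in [set: T']) (f x)%:E)%E ->
  forall x, f x = g x.
Proof.
move=> f0 fg gfin gf x.
have g0 y : 0 <= g y by exact: le_trans (fg y).
have split1 (h : T' -> R) : (forall x, 0 <= h x) -> \esum_(x in [set: T']) (h x)%:E =
    ((h x)%:E + \esum_(x in ~` [set x]) (h x)%:E)%E.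
  move=> h0; have -> := @esumID R T' [set x] setT (fun y => (h y)%:E) _.
    by rewrite !setTI esum_set1 ?lee_fin.
  by move=> ? _; rewrite lee_fin.
move: gfin gf; rewrite (split1 g g0) (split1 f f0).
have : (\esum_(x in ~` [set x]) (f x)%:E <= \esum_(x in ~` [set x]) (g x)%:E)%E.
  by apply: le_esum => y _; rewrite lee_fin.
have : (0 <= \esum_(x in ~` [set x]) (f x)%:E)%E.
  by apply: esum_ge0 => y _; rewrite lee_fin.
case: (esum _ _) => [a||]//; case: (esum _ _) => [b||]//=.
by rewrite !lee_fin => a0 ab _ h; apply/eqP; rewrite eq_le fg/=; lra.
Qed.

End ExtendedSums.

Section Energy.
Variables (R : realType) (d : nat) (p : R).
Local Notation T := 'rV[int]_d.
Implicit Types u v w : T -> R.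

(** The sum runs over ordered pairs of neighbours, so it is twice the p-th power of
    the gradient norm. *)
Definition energy u : \bar R :=
  \esum_(x in [set: T]) (\sum_(y <- nbrs x) `|u x - u y| `^ p)%:E.

Let energy_term_ge0 u x : 0 <= \sum_(y <- nbrs x) `|u x - u y| `^ p.
Proof. by apply: sumr_ge0 => y _; exact: powR_ge0. Qed.

Lemma energy_ge0 u : (0 <= energy u)%E.
Proof. by apply: esum_ge0 => x _; rewrite lee_fin. Qed.

Lemma grad_normE u : grad_norm p u = poweR ((2^-1)%:E * energy u)%E p^-1.
Proof.
rewrite /grad_norm /energy; congr (poweR (_ * _)%E _).
apply: eq_esum => x _; rewrite -esum_seqE ?nbrs_uniq//.
by have -> : [set y | adj y x] = [set` nbrs x] by apply/seteqP; split => y /= /nbrsP.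
Qed.

Lemma energy_automorphism g u : automorphism g -> energy (u \o g) = energy u.
Proof.
move=> ga; rewrite /energy [RHS](reindex_esum [set: T] _ g); last first.
  by rewrite setTT_bijective; case: ga.
apply: eq_esum => x _; congr EFin.
by rewrite (perm_big _ (perm_nbrs_automorphism x ga)) big_map.
Qed.

(** Averaging over an automorphism groups every edge with its image, which lets an
    inequality for the pair be summed. *)
Lemma energy_double g u : automorphism g ->
  (energy u + energy u)%E = \esum_(x in [set: T]) (\sum_(y <- nbrs x)
    (`|u x - u y| `^ p + `|u (g x) - u (g y)| `^ p))%:E.
Proof.
move=> ga; rewrite -{2}(energy_automorphism u ga) /energy -esumD.
- by apply: eq_esum => x _; rewrite -EFinD big_split.
- by move=> x _; rewrite lee_fin.
- by move=> x _; rewrite lee_fin -/((u \o g) x) energy_term_ge0.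
Qed.

Lemma energy_symmetrization g u v : automorphism g ->
  (forall x y, adj x y ->
     `|v x - v y| `^ p + `|v (g x) - v (g y)| `^ p <=
     `|u x - u y| `^ p + `|u (g x) - u (g y)| `^ p) ->
  (energy v <= energy u)%E /\
  ((energy u < +oo)%E -> energy v = energy u -> forall x y, adj x y ->
     `|v x - v y| `^ p + `|v (g x) - v (g y)| `^ p =
     `|u x - u y| `^ p + `|u (g x) - u (g y)| `^ p).
Proof.
move=> ga h; have gsum x : \sum_(y <- nbrs x)
    (`|v x - v y| `^ p + `|v (g x) - v (g y)| `^ p) <= \sum_(y <- nbrs x)
    (`|u x - u y| `^ p + `|u (g x) - u (g y)| `^ p).
  by rewrite big_seq [leRHS]big_seq; apply: ler_sum => y /nbrsP/adj_sym/h.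
split.
  apply: addee_le; rewrite ?energy_ge0// !(energy_double _ ga).
  by apply: le_esum => x _; rewrite lee_fin.
move=> fin E x y xy.
set f := fun x => \sum_(y <- nbrs x)
  (`|v x - v y| `^ p + `|v (g x) - v (g y)| `^ p).
set f' := fun x => \sum_(y <- nbrs x)
  (`|u x - u y| `^ p + `|u (g x) - u (g y)| `^ p).
have ff' : f x = f' x.
  apply: esum_le_eq => //.
  - by move=> z; apply: sumr_ge0 => ? _; rewrite addr_ge0 ?powR_ge0.
  - by rewrite -energy_double// lte_add_pinfty.
  - by rewrite -!energy_double// E.
have /eqP : f' x - f x = 0 by rewrite ff' subrr.
rewrite -sumrB big_seq psumr_eq0; last first.
  by move=> z /nbrsP/adj_sym/h; rewrite subr_ge0.
move=> /allP/(_ y); have /adj_sym/nbrsP -> := xy.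
by move=> /(_ isT) /=; rewrite subr_eq0 => /eqP.
Qed.

(** Lower semicontinuity under uniform approximation. Only finitely many edges have
    to be controlled at a time, and the tangent inequality bounds the loss on each of
    them by a constant times the distance [t]. *)
Lemma energy_lsc w (C : \bar R) : 1 <= p ->
  (forall t, 0 < t -> exists2 v, (energy v <= C)%E &
     forall x, `|v x - w x| <= t) ->
  (energy w <= C)%E.
Proof.
move=> p1 H; apply: ge_ereal_sup => _ [X [finX _] <-].
(* Twice the derivative of the power at [`|w x - w y|], with value 0 when that is 0. *)
pose c x y := `|w x - w y| `^ p * (p * (2 / `|w x - w y|)).
have c0 x y : 0 <= c x y.
  by rewrite !mulr_ge0 ?powR_ge0 ?invr_ge0//; lra.
have close v t x y : 0 <= t -> `|v x - w x| <= t -> `|v y - w y| <= t ->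
    `|w x - w y| `^ p <= `|v x - v y| `^ p + t * c x y.
  move=> t0 hx hy; rewrite /c; case: (eqVneq (w x) (w y)) => [->|wn].
    by rewrite subrr normr0 powR0 ?gt_eqF ?mul0r ?mulr0 ?addr0 ?powR_ge0//; lra.
  set a := `|w x - w y|; set b := `|v x - v y|.
  have a0 : 0 < a by rewrite normr_gt0 subr_eq0.
  have [tg _] := powR_tangent p1 a0 (normr_ge0 (v x - v y)).
  have ab : a - 2 * t <= b.
    have -> : a = `|(v x - v y) - (v x - w x) + (v y - w y)| by congr `|_|; ring.
    have := ler_normD (v x - v y - (v x - w x)) (v y - w y).
    have := ler_normB (v x - v y) (v x - w x).
    by rewrite /b; lra.
  have aa : b / a >= 1 - t * (2 / a).
    rewrite ler_pdivlMr// (_ : _ * a = a - t * (2 / a * a)); last by ring.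
    by rewrite divfK ?gt_eqF//; lra.
  have ap : 0 < a `^ p by rewrite powR_gt0.
  rewrite -/b in tg; set z := 2 / a in aa *.
  have : p * (- (t * z)) <= p * (b / a - 1) by rewrite ler_pM2l//; lra.
  rewrite -(ler_pM2l ap); lra.
pose K := \sum_(x \in X) \sum_(y <- nbrs x) c x y.
have K0 : 0 <= K by apply: fsumr_ge0 => x _; apply: sumr_ge0.
apply/lee_addgt0Pr => e e0; pose t := e / (K + 1).
have t0 : 0 < t by rewrite divr_gt0//; lra.
have [v vC vw] := H _ t0.
rewrite fsumEFin//; apply: (@le_trans _ _ ((\sum_(x \in X)
   (\sum_(y <- nbrs x) `|v x - v y| `^ p)) + t * K)%:E).
  rewrite lee_fin /K !fsbig_finite// mulr_sumr -big_split/=.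
  apply: ler_sum => x _; rewrite mulr_sumr -big_split/=; apply: ler_sum => y _.
  by apply: close => //; exact: ltW.
rewrite EFinD; apply: leeD.
  rewrite -fsumEFin//; apply: le_trans vC; apply: esum_ge.
  by exists X.
rewrite lee_fin /t mulrAC ler_pdivrMr; last lra.
by rewrite ler_pM2l//; lra.
Qed.

(** Pointwise [`|u x - u y| `^ p <= u x `^ p + u y `^ p] for nonnegative [u]. *)
Lemma lp_energy_fin u : 1 <= p -> (forall x, 0 <= u x) -> in_lp p u ->
  (energy u < +oo)%E.
Proof.
move=> p1 u0 ulp; have p0 : 0 <= p by lra.
pose f x := u x `^ p.
have uf : (\esum_(x in [set: T]) (f x)%:E < +oo)%E.
  rewrite (le_lt_trans _ ulp)//; apply: le_esum => x _.
  by rewrite /f ger0_norm.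
have shift (a : T) : \esum_(x in [set: T]) (f (x + a))%:E = \esum_(x in [set: T]) (f x)%:E.
  rewrite [RHS](reindex_esum [set: T] _ (fun x => x + a))//.
  by rewrite setTT_bijective; exists (fun x => x - a) => x; rewrite ?addrK ?subrK.
have bnd x : \sum_(y <- nbrs x) `|u x - u y| `^ p <= \sum_(y <- nbrs x) (f x + f y).
  apply: ler_sum => y _; rewrite /f.
  case: (leP (u x) (u y)) => h.
    apply: (@le_trans _ _ (u y `^ p)); last by rewrite lerDr powR_ge0.
    rewrite ge0_ler_powR ?nnegrE//; have := u0 x; rewrite ler0_norm; lra.
  apply: (@le_trans _ _ (u x `^ p)); last by rewrite lerDl powR_ge0.
  rewrite ge0_ler_powR ?nnegrE//; have := u0 y; rewrite ger0_norm; lra.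
have f0 x : 0 <= f x by exact: powR_ge0.
apply: (@le_lt_trans _ _ (\esum_(x in [set: T])
   (\sum_(a <- nbrs (0 : T)) ((f x)%:E + (f (x + a))%:E))%E)).
  apply: le_esum => x _; rewrite sumEFin lee_fin (le_trans (bnd x))//.
  rewrite {1 2}/nbrs !big_cat/= !big_map.
  by apply: lerD; apply: ler_sum => i _; rewrite ?add0r ?sub0r.
rewrite esum_sum; last by move=> *; rewrite adde_ge0 ?lee_fin.
under eq_bigr => a _.
  rewrite esumD; first rewrite shift; first over.
  - by move=> *; rewrite lee_fin.
  - by move=> *; rewrite lee_fin.
by apply: lte_sum_pinfty => a _; rewrite lte_add_pinfty.
Qed.

Lemma lp_level_finite u : 1 <= p -> (forall x, 0 <= u x) -> in_lp p u ->
  forall t, 0 < t -> finite_set [set x | t < u x].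
Proof.
move=> p1 u0 ulp t t0; apply: contrapT => inf.
have tp : 0 < t `^ p by rewrite powR_gt0.
have : in_lp p u by [].
rewrite /in_lp; case E : (esum _ _) => [a||]// _; last first.
  have : (0 <= \esum_(x in [set: T]) (`|u x| `^ p)%:E)%E.
    by apply: esum_ge0 => x _; rewrite lee_fin powR_ge0.
  by rewrite E.
have [n an] : exists n : nat, a / t `^ p < n%:R.
  by exists (Num.truncn (a / t `^ p)).+1; exact: truncnS_gt.
have [B BA nB] := infinite_set_fset n inf.
suff : (n%:R * t `^ p <= a) by rewrite leNgt -ltr_pdivrMr// an.
rewrite -lee_fin -E; apply: esum_ge; exists [set` B]; first by split.
rewrite -fsbig_seq ?fset_uniq// sumEFin lee_fin.
apply: (@le_trans _ _ (\sum_(x <- B) t `^ p)).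
  rewrite big_const_seq count_predT iter_addr_0 -[leRHS]mulr_natl ler_pM2r//.
  by rewrite ler_nat.
rewrite big_seq [leRHS]big_seq; apply: ler_sum => x /BA /= tx.
by rewrite ge0_ler_powR ?nnegrE ?ger0_norm//; lra.
Qed.

End Energy.

(** * Directions, reflections and the weight *)

(** The position of [z / 2] in the order 0, 1, -1, 2, -2, ... of the integers, or
    1/2, -1/2, 3/2, ... of the half-integers. Doubling puts both cases in one
    formula. *)
Definition rank (z : int) : nat := if z <= 0 then `|1 - z|%N else `|z|%N.

Lemma rankP z : ((0 < z) /\ (rank z)%:Z = z) \/ ((z <= 0) /\ (rank z)%:Z = 1 - z).
Proof. by rewrite /rank; case: ifP => h; [right|left]; split; lia. Qed.

Lemma rank_gt0 (z : int) : (0 < rank z)%N.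
Proof. by case: (rankP z) => -[? ?]; lia. Qed.

Lemma rank_reach (h : int) (n : nat) : exists k, rank (h + 2 * k) = n.+1.
Proof.
have E := divz_eq (h - n.+1%:Z) 2.
have : ((h - n.+1%:Z) %% 2)%Z = 0 \/ ((h - n.+1%:Z) %% 2)%Z = 1 by lia.
case=> r; rewrite r in E; clear r; move: E; move: (divz _ _) => q E.
  by exists (- q); have -> : h + 2 * - q = n.+1%:Z by lia.
exists (- (q + n.+1%:Z)); have -> : h + 2 * - (q + n.+1%:Z) = - n%:Z by lia.
by rewrite /rank oppr_le0 opprK.
Qed.

Section Directions.
Variable d : nat.
Local Notation T := 'rV[int]_d.
Implicit Types x y z b : T.
Implicit Types a c k : int.

Definition dot x y : int := \sum_i x 0 i * y 0 i.

Lemma dotC x y : dot x y = dot y x.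
Proof. by apply: eq_bigr => i _; rewrite mulrC. Qed.

Lemma dotDr b x y : dot b (x + y) = dot b x + dot b y.
Proof. by rewrite -big_split; apply: eq_bigr => i _; rewrite mxE mulrDr. Qed.

Lemma dotZr b k x : dot b (k *: x) = k * dot b x.
Proof. by rewrite mulr_sumr; apply: eq_bigr => i _; rewrite mxE mulrCA. Qed.

Lemma dotDl b x y : dot (x + y) b = dot x b + dot y b.
Proof. by rewrite dotC dotDr !(dotC b). Qed.

Lemma dotZl b k x : dot (k *: x) b = k * dot x b.
Proof. by rewrite dotC dotZr dotC. Qed.

Lemma dotNr b x : dot b (- x) = - dot b x.
Proof. by rewrite -scaleN1r dotZr mulN1r. Qed.

Lemma dotNl b x : dot (- x) b = - dot x b.
Proof. by rewrite dotC dotNr dotC. Qed.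

Lemma dot_unitv b i : dot b (unitv i) = b 0 i.
Proof.
rewrite /dot (bigD1 i)//= unitvE eqxx mulr1 big1 ?addr0// => j ji.
by rewrite unitvE eq_sym (negbTE ji) mulr0.
Qed.

(** A point close to the origin, scaled by [4 * d]. Its coordinates are positive and
    decrease, so that its height in every direction lies strictly between 0 and 1;
    this breaks the ties between a point and its mirror image as [rank] does. *)
Definition center : T := \row_i (d - i)%:Z.

(** The squared distance to the centre, scaled to be a natural number. *)
Definition weight x : nat :=
  `|dot ((4 * d)%:Z *: x - center) ((4 * d)%:Z *: x - center)|%N.

(** What is used of a vector [b], the smallest integer step along a line, and of
    the integer [c] for which [c * dot b x] is twice the coordinate of [x] along it.
    The fields
    [reflect_unitv] and [coef_entry] say that mirrors orthogonal to [b] map edges to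
    edges, and that an edge crosses a mirror only when it is orthogonal to it. *)
Record lattice_direction b c : Prop := LatticeDirection {
  coef_gt0 : 0 < c;
  coef_dot : c * dot b b = 2;
  entry1 : exists i, b 0 i = 1;
  reflect_unitv : forall m, exists m',
    unitv m - (c * b 0 m) *: b = unitv m' \/
    unitv m - (c * b 0 m) *: b = - unitv m';
  coef_entry : forall m, `|c * b 0 m| <= 1 \/ (c * b 0 m = 2 /\ b = unitv m);
  center_gt : 0 < dot b center;
  center_lt : c * dot b center < (4 * d)%:Z }.

Lemma lattice_direction_axis i : lattice_direction (unitv i) 2.
Proof.
have id := ltn_ord i.
split=> //.
- by rewrite dot_unitv unitvE eqxx.
- by exists i; rewrite unitvE eqxx.
- move=> m; exists m; rewrite unitvE; case: (eqVneq i m) => [->|_].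
    by right; rewrite mulr1 scaler_nat mulr2n opprD addrA subrr add0r.
  by left; rewrite mulr0 scale0r subr0.
- move=> m; rewrite unitvE; case: (eqVneq i m) => [->|_]; first by right.
  by left.
- by rewrite dotC dot_unitv mxE; lia.
- by rewrite dotC dot_unitv mxE; lia.
Qed.

Lemma lattice_direction_plus (i j : 'I_d) : (i < j)%N ->
  lattice_direction (unitv i + unitv j) 1.
Proof.
move=> ij; have id := ltn_ord i; have jd := ltn_ord j.
have nij : (i == j) = false by apply/negbTE; rewrite neq_ltn ij.
have nji : (j == i) = false by rewrite eq_sym.
have E m : (unitv i + unitv j) 0 m = (i == m)%:R + (j == m)%:R.
  by rewrite mxE !unitvE.
split=> //.
- by rewrite dotDr !dot_unitv !E !eqxx nij nji.
- by exists i; rewrite E eqxx nji.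
- move=> m; rewrite E mul1r; case: (eqVneq i m) => [<-|im].
    exists j; right; rewrite nji addr0 scale1r.
    by rewrite opprD addrA subrr add0r.
  case: (eqVneq j m) => [<-|jm].
    exists i; right; rewrite add0r scale1r.
    by rewrite opprD addrCA subrr addr0.
  by exists m; left; rewrite addr0 scale0r subr0.
- move=> m; left; rewrite E; case: (eqVneq i m) => [<-|im]; rewrite ?nji//.
  by case: (eqVneq j m).
- by rewrite dotC dotDr !dot_unitv !mxE; lia.
- by rewrite dotC dotDr !dot_unitv !mxE; lia.
Qed.

Lemma lattice_direction_minus (i j : 'I_d) : (i < j)%N ->
  lattice_direction (unitv i - unitv j) 1.
Proof.
move=> ij; have id := ltn_ord i; have jd := ltn_ord j.
have nij : (i == j) = false by apply/negbTE; rewrite neq_ltn ij.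
have nji : (j == i) = false by rewrite eq_sym.
have E m : (unitv i - unitv j) 0 m = (i == m)%:R - (j == m)%:R.
  by rewrite !mxE !eqxx !(eq_sym m).
split=> //.
- by rewrite dotDr dotNr !dot_unitv !E !eqxx nij nji.
- by exists i; rewrite E eqxx nji.
- move=> m; rewrite E mul1r; case: (eqVneq i m) => [<-|im].
    by exists j; left; rewrite nji subr0 scale1r subKr.
  case: (eqVneq j m) => [<-|jm].
    by exists i; left; rewrite sub0r scaleN1r opprK addrC subrK.
  by exists m; left; rewrite subr0 scale0r subr0.
- move=> m; left; rewrite E; case: (eqVneq i m) => [<-|im]; rewrite ?nji//.
  by case: (eqVneq j m).
- by rewrite dotC dotDr dotNr !dot_unitv !mxE; lia.
- by rewrite dotC dotDr dotNr !dot_unitv !mxE; lia.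
Qed.

End Directions.

Section Reflections.
Variables (d : nat) (b : 'rV[int]_d) (c : int).
Hypothesis dir : lattice_direction b c.
Local Notation T := 'rV[int]_d.
Implicit Types x y z : T.
Implicit Types a k : int.

(** Twice the inner product with the direction, hence an integer. *)
Definition height x : int := c * dot b x.

(** The mirror image of [x] in the hyperplane of points of height [a]. *)
Definition reflection a x : T := x + (a - height x) *: b.

(** [x] precedes its mirror image in the order of its line. *)
Definition better a x : bool := (rank (height x) < rank (height (reflection a x)))%N.

Lemma heightDZ x k : height (x + k *: b) = height x + 2 * k.
Proof. by rewrite /height dotDr dotZr mulrDr mulrCA (coef_dot dir) (mulrC k). Qed.

Lemma heightB x y : height (x - y) = height x - height y.
Proof. by rewrite /height dotDr dotNr mulrBr. Qed.

Lemma height_unitv i : height (unitv i) = c * b 0 i.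
Proof. by rewrite /height dot_unitv. Qed.

Lemma heightN x : height (- x) = - height x.
Proof. by rewrite /height dotNr mulrN. Qed.

Lemma height_reflection a x : height (reflection a x) = 2 * a - height x.
Proof. by rewrite heightDZ; lia. Qed.

Lemma reflectionK a : involutive (reflection a).
Proof.
move=> x; rewrite {1}/reflection height_reflection /reflection -addrA -scalerDl.
by rewrite (_ : (a - height x) + _ = 0) ?scale0r ?addr0//; lia.
Qed.

Lemma reflection_fix a x : height x = a -> reflection a x = x.
Proof. by move=> h; rewrite /reflection h subrr scale0r addr0. Qed.

Lemma reflection_neq a x : height x != a -> reflection a x != x.
Proof.
by apply: contra => /eqP /(congr1 height); rewrite height_reflection; lia.
Qed.

Lemma reflection_adj a x y : adj x y -> adj (reflection a x) (reflection a y).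
Proof.
have E : reflection a x - reflection a y = (x - y) - height (x - y) *: b.
  rewrite /reflection heightB opprD addrACA; congr (_ + _).
  by rewrite -scalerBl -scaleNr; congr (_ *: _); lia.
case=> i xy; rewrite /adj; have [m] := reflect_unitv dir i.
rewrite E -/(unitv i) -height_unitv => h; exists m.
case: xy => ->; rewrite -/(unitv i) -/(unitv m); first by [].
rewrite heightN scaleNr -opprD; case: h => ->; [right|left] => //.
by rewrite opprK.
Qed.

Lemma reflection_automorphism a : automorphism (reflection a).
Proof.
split; first exact: inv_bij (reflectionK a).
move=> x y; split=> [|/(reflection_adj a)]; first exact: reflection_adj.
by rewrite !reflectionK.
Qed.

(** An edge changes the height by at most 1, except in an axis direction, where it may
    change it by 2; in that case its midpoint is on the mirror. *)
Lemma reflection_cross a x y : adj x y -> height x < a -> a < height y ->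
  y = reflection a x.
Proof.
case=> m xy xa ay; have hB := heightB x y.
case: xy => xy; rewrite xy -/(unitv m) ?heightN height_unitv in hB.
  by case: (coef_entry dir m) => [|[]]; lia.
case: (coef_entry dir m) => [|[h bm]]; first by lia.
rewrite /reflection (_ : a - height x = 1); last by lia.
by rewrite scale1r bm /unitv -[delta_mx 0 m]opprK -xy opprB addrCA subrr addr0.
Qed.

Lemma betterC a x : height x != a ->
  better a (reflection a x) = ~~ better a x.
Proof.
rewrite /better reflectionK height_reflection.
case: (rankP (height x)) => -[? h1];
case: (rankP (2 * a - height x)) => -[? h2]; lia.
Qed.

Lemma betterE a x : better a x = if 1 <= a then height x < a else a < height x.
Proof.
rewrite /better height_reflection.
case: (rankP (height x)) => -[? h1];
case: (rankP (2 * a - height x)) => -[? h2]; case: ifP; lia.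
Qed.

(** An edge avoiding the mirror stays on one side of it or joins two mirror images,
    and all the points on one side are simultaneously better or worse. *)
Lemma adj_better a x y : adj x y -> height x != a -> height y != a ->
  y = reflection a x \/ better a x = better a y.
Proof.
move=> xy xa ya; rewrite !betterE.
case: (ltgtP (height x) a) xa => // xa _; case: (ltgtP (height y) a) ya => // ya _;
  try by right; case: ifP.
  by left; exact: reflection_cross.
left; rewrite -[LHS](reflectionK a) -(reflection_cross (adj_sym xy))//.
Qed.

(** Along the line the weight is a quadratic polynomial of the height, with minimum at
    a height strictly between 0 and 1, hence it is ordered as the rank is. *)
Lemma weight_lt x k :
  (rank (height x) < rank (height (x + k *: b)))%N ->
  (weight x < weight (x + k *: b))%N.
Proof.
rewrite heightDZ => hr.
have {}hr : 0 < k * (2 * (height x + k) - 1).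
  case: (rankP (height x)) => -[? h1];
  case: (rankP (height x + 2 * k)) => -[? h2]; nia.
rewrite /weight; set M : int := (4 * d)%:Z; set w := center d.
have E (z : T) : dot z z = \sum_i z 0 i ^+ 2.
  by apply: eq_bigr => i _; rewrite expr2.
have pos (z : T) : 0 <= dot z z by rewrite E sumr_ge0// => i _; exact: sqr_ge0.
rewrite -ltz_nat !gez0_abs// -subr_gt0.
have -> : M *: (x + k *: b) - w = (M *: x - w) + (M * k) *: b.
  by rewrite scalerDr scalerA addrAC.
rewrite !(dotDr, dotDl, dotZr, dotZl, dotNr, dotNl) (dotC x b) (dotC w b).
have := coef_gt0 dir; have := coef_dot dir; have := center_gt dir; have := center_lt dir.
rewrite -/M -/w; move: hr; rewrite /height.
set W := dot b w; set N := dot b b; set X := dot b x.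
move=> hr WM W0 cN c0; set Y := (Y in 0 < Y).
(* Up to a positive factor, the difference of the weights is [k] times the signed
   distance from the midpoint [c * X + k] to the centre. *)
have cY : c * Y = 2 * M * (k * (M * (c * X + k) - c * W)).
  transitivity (2 * M * k * (M * (c * X) - c * W) + M * k * M * k * (c * N)).
    by rewrite /Y (dotC w x); ring.
  by rewrite cN; ring.
rewrite -(pmulr_rgt0 Y c0) cY; have cW0 : 0 < c * W by rewrite mulr_gt0.
have M0 : 0 < M by lia.
apply: mulr_gt0; first (by lia); set C := c * X + k in hr *; set V := c * W in WM cW0 *.
have [k0|k0|k0] := ltgtP k 0; last by rewrite k0 mul0r in hr.
- have C0 : C <= 0 by nia.
  have : M * C - V < 0 by nia.
  by nia.
- have C0 : 1 <= C by nia.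
  have : 0 < M * C - V by nia.
  by nia.
Qed.

End Reflections.

(** * Polarization *)

Section AdmissibleFunctions.
Variables (R : realType) (d : nat).
Local Notation T := 'rV[int]_d.
Implicit Types (x y : T) (u : T -> R) (A : set T).

Definition superlevel u (t : R) : set T := [set x | t < u x].

(** Nonnegative functions tending to zero at infinity. *)
Definition vanishing u : Prop :=
  (forall x, 0 <= u x) /\ forall t, 0 < t -> finite_set (superlevel u t).

Definition inj_positive u : Prop :=
  forall x y, 0 < u x -> u x = u y -> x = y.

(** The graph induced on the support, read on values instead of points. When the
    positive values are distinct this relation determines the function up to a graph
    isomorphism of its support, and it makes sense for a limit of functions. *)
Definition adj_values u (s t : R) : Prop :=
  exists x y, [/\ adj x y, u x = s & u y = t].

(** Total weight of a finite set of points. *)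
Definition moment (A : set T) : nat := (\sum_(x \in A) weight x)%N.

End AdmissibleFunctions.

Section Polarization.
Variables (R : realType) (d : nat) (b : 'rV[int]_d) (c : int).
Hypothesis dir : lattice_direction b c.
Local Notation T := 'rV[int]_d.
Implicit Types (x y z : T) (u : T -> R) (a k : int) (p : R).
Local Notation height := (height b c).
Local Notation reflection := (reflection b c).
Local Notation better := (better b c).

Definition swapped a u x : bool :=
  (better a x && (u x < u (reflection a x))) ||
  (better a (reflection a x) && (u (reflection a x) < u x)).

Definition swap a u x : T := if swapped a u x then reflection a x else x.

(** Two-point rearrangement: in each pair of mirror images the larger value is put at
    the point of smaller rank. Writing it as [u] composed with an involution makes it
    plain that the values and their multiplicities are unchanged. *)
Definition polarization a u : T -> R := u \o swap a u.

Lemma swapped_reflection a u x : swapped a u (reflection a x) = swapped a u x.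
Proof. by rewrite /swapped (reflectionK dir) orbC. Qed.

Lemma swap_reflection a u x : swap a u (reflection a x) = reflection a (swap a u x).
Proof. by rewrite /swap swapped_reflection; case: ifP. Qed.

Lemma swapK a u : involutive (swap a u).
Proof.
move=> x; rewrite {2}/swap; case E: (swapped a u x); last by rewrite /swap E.
by rewrite swap_reflection /swap E (reflectionK dir).
Qed.

Lemma polarization_better a u x : better a x ->
  u (reflection a x) <= polarization a u x.
Proof.
move=> bx; rewrite /polarization /swap /swapped /= bx /=.
case: ifP => // /negbT; rewrite negb_or => /andP[].
by rewrite -leNgt.
Qed.

Lemma reflection_polarization a u x :
  polarization a u x = (if swapped a u x then u (reflection a x) else u x) /\
  polarization a u (reflection a x) = (if swapped a u x then u x else u (reflection a x)).
Proof.
rewrite /polarization /= swap_reflection /swap.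
by case: ifP => _; rewrite ?(reflectionK dir).
Qed.

Lemma swapped_same_side a u x y : better a x = better a y ->
  height x != a -> height y != a ->
  swapped a u x -> ~~ swapped a u y ->
  (u x < u (reflection a x) /\ u (reflection a y) <= u y) \/
  (u (reflection a x) < u x /\ u y <= u (reflection a y)).
Proof.
move=> bxy xa ya; rewrite /swapped !betterC// -bxy.
by case: better => /=; rewrite ?orbF -?leNgt => ->; [left|right].
Qed.

(** Only an edge with exactly one swapped endpoint matters. Its endpoints lie on the
    same side of the mirror, where [u] increases across the mirror at one of them and
    decreases at the other, so [exchange_powR] applies. *)
Lemma polarization_edge p a u x y : 1 <= p -> adj x y ->
  `|polarization a u x - polarization a u y| `^ p +
  `|polarization a u (reflection a x) - polarization a u (reflection a y)| `^ p <=
  `|u x - u y| `^ p + `|u (reflection a x) - u (reflection a y)| `^ p.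
Proof.
move=> p1 xy.
have [-> ->] := reflection_polarization a u x.
have [-> ->] := reflection_polarization a u y.
have [/eqP xa|xa] := boolP (height x == a).
  by rewrite (reflection_fix xa) if_same; case: ifP => // _; rewrite addrC.
have [/eqP ya|ya] := boolP (height y == a).
  by rewrite (reflection_fix ya) if_same; case: ifP => // _; rewrite addrC.
have [->|bxy] := adj_better dir xy xa ya.
  by rewrite swapped_reflection (reflectionK dir); case: ifP => // _; rewrite addrC.
case sx : (swapped a u x); case sy : (swapped a u y) => //; first by rewrite addrC.
  have [[h1 h2]|[h1 h2]] := swapped_same_side bxy xa ya sx (negbT sy).
    by have [] := exchange_powR p1 (ltW h1) h2; rewrite addrC [leRHS]addrC.
  by have [] := exchange_powR p1 (ltW h1) h2; rewrite addrC [leRHS]addrC addrC [leRHS]addrC.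
rewrite ![ `|u x - _|]distrC ![ `|u (reflection a x) - _|]distrC.
have [[h1 h2]|[h1 h2]] := swapped_same_side (esym bxy) ya xa sy (negbT sx).
  by have [] := exchange_powR p1 (ltW h1) h2; rewrite addrC [leRHS]addrC.
by have [] := exchange_powR p1 (ltW h1) h2; rewrite addrC [leRHS]addrC addrC [leRHS]addrC.
Qed.

Lemma polarization_energy p a u : 1 <= p ->
  (energy p (polarization a u) <= energy p u)%E.
Proof.
move=> p1; have [] := energy_symmetrization (p := p) (u := u)
  (v := polarization a u) (reflection_automorphism dir a) => //.
by move=> x y; exact: polarization_edge.
Qed.

(** With no loss of energy, the strict case of [exchange_powR] forbids an edge with
    exactly one swapped endpoint, unless one of the two pairs of mirror images carries
    equal values; for distinct positive values this happens only on the mirror or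
    where both values are zero. *)
Lemma polarization_rigid p a u : 1 < p -> (energy p u < +oo)%E ->
  (forall x, 0 <= u x) -> inj_positive u ->
  energy p (polarization a u) = energy p u ->
  forall x y, adj x y ->
    (0 < u x \/ 0 < u (reflection a x)) -> (0 < u y \/ 0 < u (reflection a y)) ->
    adj (swap a u x) (swap a u y).
Proof.
move=> p1 fin u0 uinj E x y xy ux uy; have p1' := ltW p1.
have [_ /(_ fin E) eq] := energy_symmetrization (p := p) (u := u)
  (v := polarization a u) (reflection_automorphism dir a)
  (fun x y => @polarization_edge p a u x y p1').
have refl_adj := reflection_adj dir a.
have one x' y' : adj x' y' -> height x' != a -> height y' != a ->
    better a x' = better a y' -> swapped a u x' -> ~~ swapped a u y' ->
    (0 < u y' \/ 0 < u (reflection a y')) -> False.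
  move=> xy' xa ya bxy sx sy uy'; have := eq _ _ xy'.
  have [-> ->] := reflection_polarization a u x'.
  have [-> ->] := reflection_polarization a u y'.
  rewrite sx (negbTE sy).
  have une : u y' != u (reflection a y').
    apply/negP => /eqP e; move/eqP: (reflection_neq dir ya); apply.
    by apply: uinj; [case: uy' => //; rewrite e|].
  have [[h1 h2]|[h1 h2]] := swapped_same_side bxy xa ya sx sy.
    have [_ /(_ p1 h1)] := exchange_powR p1' (ltW h1) h2.
    by rewrite lt_neqAle h2 eq_sym une; lra.
  have [_ /(_ p1 h1)] := exchange_powR p1' (ltW h1) h2.
  by rewrite lt_neqAle h2 une; lra.
have [/eqP xa|xa] := boolP (height x == a).
  rewrite /swap (reflection_fix xa) if_same; case: ifP => // _.
  by rewrite -(reflection_fix (b := b) (c := c) xa); exact: refl_adj.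
have [/eqP ya|ya] := boolP (height y == a).
  rewrite /swap (reflection_fix ya) if_same; case: ifP => // _.
  by rewrite -(reflection_fix (b := b) (c := c) ya); exact: refl_adj.
have [yx|bxy] := adj_better dir xy xa ya.
  rewrite yx swap_reflection /swap; case: ifP => _; last by rewrite -yx.
  by apply: refl_adj; rewrite -yx.
rewrite /swap.
case sx : (swapped a u x); case sy : (swapped a u y) => //; first exact: refl_adj.
  by case: (one _ _ xy xa ya bxy sx (negbT sy) uy).
by case: (one _ _ (adj_sym xy) ya xa (esym bxy) sy (negbT sx) ux).
Qed.

Lemma polarization_adj_values p a u : 1 < p -> (energy p u < +oo)%E ->
  (forall x, 0 <= u x) -> inj_positive u ->
  energy p (polarization a u) = energy p u ->
  forall s t, 0 < s -> 0 < t ->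
    adj_values u s t <-> adj_values (polarization a u) s t.
Proof.
move=> p1 fin u0 uinj E s t s0 t0.
have rigid := polarization_rigid p1 fin u0 uinj E.
split=> -[x [y [xy xs yt]]].
  exists (swap a u x), (swap a u y); rewrite /polarization /= !swapK; split=> //.
  by apply: rigid; rewrite ?xs ?yt//; left.
exists (swap a u x), (swap a u y); split=> //; apply: rigid => //.
  by move: s0; rewrite -xs /polarization /= /swap; case: ifP => _; [right|left].
by move: t0; rewrite -yt /polarization /= /swap; case: ifP => _; [right|left].
Qed.

(** A polarization acts on a superlevel set as on its indicator function [chi], moving
    points only towards smaller weight. *)
Lemma polarization_moment a u t : finite_set (superlevel u t) ->
  superlevel (polarization a u) t = superlevel u t \/
  (moment (superlevel (polarization a u) t) < moment (superlevel u t))%N.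
Proof.
move=> fin; pose chi x : R := (t < u x)%R%:R.
rewrite /superlevel in fin *; set A := [set x | t < u x] in fin *.
set f := swap a chi.
have fK : involutive f by exact: swapK.
have -> : [set x | t < polarization a u x] = f @` A.
  have E x : (t < polarization a u x) = (t < u (f x)).
    rewrite /polarization /f /= /swap /swapped /chi.
    case: (better a x); case: (better a _) => //=; rewrite ?orbF;
      case: (ltP t (u x)); case: (ltP t (u (reflection a x))) => h1 h2;
      rewrite ?ltxx ?ltr01 ?ltr10 //=; case: ifP => //; lra.
  apply/seteqP; split=> x /=; rewrite E => h.
    by exists (f x).
  by case: h => y Ay <-; rewrite fK.
have le x : A x -> f x = x \/ (weight (f x) < weight x)%N.
  rewrite /A /f /= => Ax; rewrite /swap; case: ifP => [b0|_]; last by left.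
  right; move: b0; rewrite /swapped.
  case/orP => /andP[bx].
    by rewrite /chi Ax ltNge; case: (t < _); rewrite ?lexx ?ler01.
  by move: bx => /(weight_lt dir); rewrite -/(reflection a (reflection a x)) (reflectionK dir).
have [fA|] := pselect (forall x, A x -> f x = x).
  left; apply/seteqP; split=> x /=; first by move=> [y Ay <-]; rewrite fA.
  by move=> Ax; exists x; rewrite ?fA.
move=> /existsNP[x0 /not_implyP[Ax0 /eqP fx0]]; right.
rewrite /moment fsbig_image; last by move=> x y _ _ /(can_inj fK).
rewrite !fsbig_finite//=.
have x0A : x0 \in fset_set A by rewrite in_fset_set//; exact: mem_set.
rewrite (bigD1_seq x0) ?fset_uniq//= [X in (_ < X)%N](bigD1_seq x0) ?fset_uniq//=.
rewrite -addSn leq_add//.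
  by have [/eqP|] := le _ Ax0; rewrite ?(negbTE fx0).
rewrite big_seq_cond [leqRHS]big_seq_cond; apply: leq_sum => x /andP[].
by rewrite in_fset_set// => /set_mem/le[->|/ltnW].
Qed.

End Polarization.

(** * Sequences of improvements converge *)

(** A natural number strictly decreases at each change. *)
Lemma eventually_constant (A : Type) (f : nat -> A) (m : A -> nat) :
  (forall k, f k.+1 = f k \/ (m (f k.+1) < m (f k))%N) ->
  exists K, forall k, (K <= k)%N -> f k = f K.
Proof.
move=> H.
have mono K k : (K <= k)%N -> f k = f K \/ (m (f k) < m (f K))%N.
  elim: k => [|k IH]; first by rewrite leqn0 => /eqP ->; left.
  rewrite leq_eqVlt => /orP[/eqP ->|]; first by left.
  rewrite ltnS => /IH; case: (H k) => [->//|h1 [h2|h2]]; right.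
    by rewrite -h2.
  exact: ltn_trans h2.
have claim n K : (m (f K) <= n)%N -> exists K, forall k, (K <= k)%N -> f k = f K.
  elim: n K => [|n IH] K mK.
    exists K => k /mono[//|]; move: mK; rewrite leqn0 => /eqP ->.
    by rewrite ltn0.
  have [h|] := pselect (forall k, (K <= k)%N -> f k = f K); first by exists K.
  move=> /existsNP[k /not_implyP[Kk fk]]; apply: (IH k).
  case: (mono _ _ Kk) => // lt; rewrite -ltnS; exact: leq_trans mK.
exact: (claim _ 0%N (leqnn _)).
Qed.

Section MaxTruncation.
Variable R : realType.
Implicit Types a b s t : R.

Lemma max_eq_lt a b t : Num.max a t = Num.max b t -> (t < a) = (t < b).
Proof. by rewrite !maxEle; case: (leP a t); case: (leP b t) => //; lra. Qed.

Lemma max_eq_val a b s t : Num.max a t = Num.max b t -> t < s -> a = s <-> b = s.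
Proof. by rewrite !maxEle; case: (leP a t); case: (leP b t) => //; lra. Qed.

Lemma max_eq_dist a b t : 0 <= a -> 0 <= b -> 0 < t ->
  Num.max a t = Num.max b t -> `|a - b| <= t.
Proof.
rewrite ler_norml !maxEle => a0 b0 t0.
by case: (leP a t); case: (leP b t) => //; lra.
Qed.

End MaxTruncation.

Section Improvement.
Variables (R : realType) (d : nat) (p : R).
Hypothesis p1 : 1 <= p.
Local Notation T := 'rV[int]_d.
Implicit Types (x y z : T) (f g u v : T -> R) (w : nat -> T -> R) (s t : R).

(** Collects everything that a rearrangement inherits from polarizations: each field
    is preserved by composition and by limits, so that it holds for the one-step
    rearrangements and for their limit as soon as it holds for polarizations. *)
Record improves u v : Prop := Improves {
  improves_vanishing : vanishing v;
  improves_energy : (energy p v <= energy p u)%E;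
  improves_values : forall s, 0 < s -> (exists x, u x = s) <-> (exists x, v x = s);
  improves_inj : inj_positive u -> inj_positive v;
  improves_adj : 1 < p -> (energy p u < +oo)%E -> inj_positive u ->
    energy p v = energy p u -> forall s t, 0 < s -> 0 < t ->
    adj_values u s t <-> adj_values v s t;
  improves_moment : forall t, 0 < t -> superlevel v t = superlevel u t \/
    (moment (superlevel v t) < moment (superlevel u t))%N }.

Lemma improves_refl u : vanishing u -> improves u u.
Proof. by move=> ?; split=> // t _; left. Qed.

Lemma improves_trans v u f : improves u v -> improves v f -> improves u f.
Proof.
move=> uv vw; split.
- exact: improves_vanishing vw.
- exact: le_trans (improves_energy vw) (improves_energy uv).
- by move=> s s0; rewrite (improves_values uv s0) (improves_values vw s0).
- by move=> /(improves_inj uv)/(improves_inj vw).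
- move=> pp fin inj E s t s0 t0.
  have Ev : energy p v = energy p u.
    by apply/eqP; rewrite eq_le (improves_energy uv) -E (improves_energy vw).
  rewrite (improves_adj uv)//; apply: (improves_adj vw) => //.
  + by rewrite Ev.
  + exact: improves_inj uv inj.
  + by rewrite E Ev.
- move=> t t0; case: (improves_moment vw t0) => [->|h].
    exact: improves_moment uv t t0.
  right; case: (improves_moment uv t0) => [<-//|]; exact: ltn_trans.
Qed.

Lemma improves_polarization b c a u : lattice_direction b c -> vanishing u ->
  improves u (polarization b c a u).
Proof.
move=> dir [u0 ufin]; have swK := swapK dir a u.
split.
- split=> [x|t t0]; first exact: u0.
  rewrite (_ : superlevel _ _ = swap b c a u @` superlevel u t).
    by apply: finite_image; exact: ufin.
  rewrite /superlevel; apply/seteqP; split=> x /=; first by exists (swap b c a u x).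
  by case=> y yt <-; rewrite /polarization /= swK.
- exact: polarization_energy.
- move=> s s0; split=> -[x xs]; last by exists (swap b c a u x).
  by exists (swap b c a u x); rewrite /polarization /= swK.
- move=> inj x y ux uxy; apply: (can_inj swK); exact: inj.
- by move=> pp fin inj E; exact: (polarization_adj_values dir pp fin u0 inj E).
- by move=> t t0; apply: polarization_moment => //; exact: ufin.
Qed.

(** Above any positive threshold the sequence is eventually stationary; the maximum
    with [t] hides what happens below the threshold. *)
Definition settles w v : Prop := forall t, 0 < t ->
  exists K, forall k, (K <= k)%N -> forall x, Num.max (w k x) t = Num.max (v x) t.

Lemma settles_cvg w v x : (forall k, vanishing (w k)) -> vanishing v ->
  settles w v -> w k x @[k --> \oo] --> v x.
Proof.
move=> w0 [v0 _] h; apply/cvgrPdist_le => e e0.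
have [K hK] := h _ e0; exists K => // k Kk /=.
by apply: max_eq_dist => //; [case: (w0 k)|rewrite hK].
Qed.

Section Sequence.
Variable w : nat -> T -> R.
Hypothesis w0 : vanishing (w 0%N).
Hypothesis wS : forall k, improves (w k) (w k.+1).

Lemma improves_vanishing_seq k : vanishing (w k).
Proof. by case: k => // k; exact: improves_vanishing (wS k). Qed.

Lemma improves_seq j k : (j <= k)%N -> improves (w j) (w k).
Proof.
elim: k => [|k IH]; first by rewrite leqn0 => /eqP ->; exact: improves_refl.
rewrite leq_eqVlt => /predU1P[->|]; first exact/improves_refl/improves_vanishing_seq.
rewrite ltnS => /IH h; exact: improves_trans h (wS k).
Qed.

(** The moment of the superlevel set is a natural number that decreases whenever the
    set changes. *)
Lemma superlevel_settles t : 0 < t ->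
  exists K, forall k, (K <= k)%N -> superlevel (w k) t = superlevel (w K) t.
Proof.
move=> t0; apply: (@eventually_constant _ (fun k => superlevel (w k) t) (@moment d)).
by move=> k; exact: improves_moment (wS k) t t0.
Qed.

Lemma superlevels_settle (s : seq R) : (forall t, t \in s -> 0 < t) ->
  exists K, forall k, (K <= k)%N -> forall t, t \in s ->
    superlevel (w k) t = superlevel (w K) t.
Proof.
elim: s => [|t s IH] s0; first by exists 0%N.
have [K hK] := IH (fun r rs => s0 r (@mem_behead _ (t :: s) r rs)).
have [L hL] := superlevel_settles (s0 t (mem_head _ _)).
exists (maxn K L) => k; rewrite geq_max => /andP[Kk Lk] r.
rewrite inE => /predU1P[->|rs]; first by rewrite !hL ?leq_maxr.
by rewrite !(hK _ _ r) ?leq_maxl.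
Qed.

(** Only finitely many values exceed [t]. Once the superlevel sets at [t] and at each
    of these values are stationary, so is the function where it exceeds [t]. *)
Lemma truncations_settle t : 0 < t ->
  exists K, forall k, (K <= k)%N -> forall x, Num.max (w k x) t = Num.max (w K x) t.
Proof.
move=> t0; have [_ fin] := w0.
have /finite_seqP[s sE] : finite_set (w 0%N @` superlevel (w 0%N) t).
  exact/finite_image/fin.
have [K hK] : exists K, forall k, (K <= k)%N -> forall r, r \in t :: s ->
    superlevel (w k) r = superlevel (w K) r.
  apply: superlevels_settle.
  move=> r; rewrite inE => /predU1P[->//|rs].
  have : [set` s] r by [].
  by rewrite -sE => -[x /= xt <-]; exact: lt_trans xt.
have key k k' x : (K <= k)%N -> (K <= k')%N -> t < w k x -> w k x <= w k' x.
  move=> Kk Kk' tk; rewrite leNgt; apply/negP => lt.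
  have tk' : t < w k' x.
    have : superlevel (w k) t x by [].
    by rewrite (hK k) ?mem_head// -(hK k') ?mem_head.
  have vs : w k' x \in s.
    have [y yE] : exists y, w 0%N y = w k' x.
      by apply/(improves_values (improves_seq (leq0n k')) (lt_trans t0 tk')); exists x.
    suff : [set` s] (w k' x) by [].
    by rewrite -sE; exists y; rewrite /superlevel /= ?yE.
  have : superlevel (w k) (w k' x) x by [].
  rewrite (hK k) ?inE ?vs ?orbT// -(hK k') ?inE ?vs ?orbT// /superlevel /=.
  by rewrite ltxx.
exists K => k Kk x; case: (ltP t (w k x)) => h1.
  have h2 := key _ _ _ Kk (leqnn K) h1.
  have h3 := key _ _ _ (leqnn K) Kk (lt_le_trans h1 h2).
  by rewrite (max_l (ltW (lt_le_trans h1 h2))); apply: le_anti; rewrite h2.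
case: (ltP t (w K x)) => // h2.
by have := le_lt_trans (le_trans (key _ _ _ (leqnn K) Kk h2) h1) h2; rewrite ltxx.
Qed.

(** Each field of [improves] concerns positive values only, hence one stage at which
    the sequence has settled above a suitable threshold, except for the energy, which
    passes to the limit by lower semicontinuity. *)
Lemma improves_limit : exists2 v, settles w v & forall k, improves (w k) v.
Proof.
have /choice[K hK] : forall t : R, exists K, 0 < t ->
    forall k, (K <= k)%N -> forall x, Num.max (w k x) t = Num.max (w K x) t.
  move=> t; have [t0|t0] := ltP 0 t; last by exists 0%N.
  by have [K hK] := truncations_settle t0; exists K.
have /choice[v hv] : forall x, exists l, 0 <= l /\ forall t, 0 < t ->
    forall k, (K t <= k)%N -> Num.max (w k x) t = Num.max l t.
  move=> x; have [[t [t0 tx]]|none] := pselect (exists t, 0 < t /\ t < w (K t) x).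
    exists (w (K t) x); split=> [|r r0 k Kk].
      by have [] := improves_vanishing_seq (K t).
    (* Above [t] the value is final from [K t] on; compare at a later common index. *)
    pose k' := maxn k (K t).
    have -> : w (K t) x = w k' x.
      by apply/esym/(max_eq_val (hK t t0 k' (leq_maxr _ _) x) tx).
    by rewrite (hK r r0 k Kk) (hK r r0 k')// (leq_trans Kk)// leq_maxl.
  exists 0; split=> // t t0 k Kk; rewrite (hK t t0 k Kk x).
  have : ~ (t < w (K t) x) by move=> h; apply: none; exists t.
  by move/negP; rewrite -leNgt !maxEle => ->; rewrite (ltW t0).
have v0 x : 0 <= v x by have [] := hv x.
have hvK t k x : 0 < t -> (K t <= k)%N -> Num.max (w k x) t = Num.max (v x) t.
  by move=> t0 Kk; have [_] := hv x; apply.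
exists v; first by move=> t t0; exists (K t) => k Kk x; exact: hvK.
have lvl t k : 0 < t -> (K t <= k)%N -> superlevel v t = superlevel (w k) t.
  move=> t0 Kk; apply/seteqP; split=> x; rewrite /superlevel/=;
  by rewrite (max_eq_lt (hvK t k x t0 Kk)).
have val k s t x : 0 < t -> t < s -> (K t <= k)%N -> w k x = s <-> v x = s.
  by move=> t0 ts Kk; exact: max_eq_val (hvK t k x t0 Kk) ts.
have vle k : (energy p v <= energy p (w k))%E.
  apply: energy_lsc => // t t0; exists (w (maxn k (K t))).
    exact: improves_energy (improves_seq (leq_maxl _ _)).
  move=> x; apply: max_eq_dist => //.
    by have [] := improves_vanishing_seq (maxn k (K t)).
  by apply: hvK; rewrite ?leq_maxr.
move=> j; split.
- split=> // t t0; rewrite (lvl t (K t) t0 (leqnn _)).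
  by have [_] := improves_vanishing_seq (K t); apply.
- exact: vle.
- move=> s s0; have h0 : 0 < s / 2 by lra.
  have h1 : s / 2 < s by lra.
  rewrite (improves_values (improves_seq (leq_maxl j (K (s / 2)))) s0).
  by split=> -[x xs]; exists x; apply/(val _ _ _ _ h0 h1 (leq_maxr j (K (s / 2)))).
- move=> inj x y vx vxy; have h0 : 0 < v x / 2 by lra.
  have h1 : v x / 2 < v x by lra.
  have h := val (maxn j (K (v x / 2))) _ _ _ h0 h1 (leq_maxr _ _).
  have ex := (h x).2 erefl; have ey := (h y).2 (esym vxy).
  apply: (improves_inj (improves_seq (leq_maxl j (K (v x / 2)))) inj).
    by rewrite ex.
  by rewrite ex ey.
- move=> pp fin inj E s t s0 t0; pose r := Num.min s t / 2.
  have m0 : 0 < Num.min s t by rewrite lt_min s0.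
  have r0 : 0 < r by rewrite /r; lra.
  have rs : r < s by have := ge_min s s t; rewrite lexx /= /r; lra.
  have rt : r < t by have := ge_min t s t; rewrite lexx orbT /= /r; lra.
  pose k := maxn j (K r); have jk : (j <= k)%N by exact: leq_maxl.
  have Kk : (K r <= k)%N by exact: leq_maxr.
  have Ek : energy p (w k) = energy p (w j).
    by apply/eqP; rewrite eq_le (improves_energy (improves_seq jk)) -E vle.
  rewrite (improves_adj (improves_seq jk) pp fin inj Ek s0 t0).
  by split=> -[x [y [xy xs yt]]]; exists x, y; split=> //;
    [apply/(val k _ _ _ r0 rs Kk)|apply/(val k _ _ _ r0 rt Kk)|
     apply/(val k _ _ _ r0 rs Kk)|apply/(val k _ _ _ r0 rt Kk)].
- move=> t t0; rewrite (lvl t (maxn j (K t)))//; last exact: leq_maxr.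
  exact: improves_moment (improves_seq (leq_maxl _ _)) t t0.
Qed.

End Sequence.
End Improvement.

(** * One-step rearrangements as limits of polarizations *)

Section NthLargest.
Variables (R : realType) (d : nat).
Local Notation T := 'rV[int]_d.
Implicit Types (u : T -> R) (V O : set T) (s t : R) (n : nat).

Lemma card_ge_subset (T' : choiceType) (A : set T') n :
  (`I_n #<= A)%card -> exists2 O, O `<=` A & (O #= `I_n)%card.
Proof.
elim/choicePpointed: T' => T' in A *.
  rewrite emptyE card_le0 => /eqP ->; by exists set0; [exact: sub0set|exact: card_eq00].
move=> /pcard_leP[f]; exists (f @` `I_n); first by move=> _ [i ni <-]; exact: funS.
by apply: card_image.
Qed.

Lemma finite_lower_bound u O s : finite_set O -> (forall y, O y -> s < u y) ->
  exists2 m, s < m & forall y, O y -> m <= u y.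
Proof.
move=> /finite_seqP[r ->]; elim: r => [|x r IH] h; first by exists (s + 1) => //; lra.
have [|m sm mh] := IH; first by move=> y yr; apply: h; rewrite /= inE yr orbT.
have sx : s < u x by apply: h; rewrite /= inE eqxx.
exists (Num.min m (u x)); first by rewrite lt_min sm.
move=> y /=; rewrite inE => /predU1P[->|yr]; first by rewrite ge_min lexx orbT.
by rewrite ge_min mh.
Qed.

Lemma vanishing_bounded u : vanishing u -> exists B, forall x, u x <= B.
Proof.
move=> [u0 fin]; have [|m m0 mh] := @finite_lower_bound (fun x => (u x + 1)^-1)
  (superlevel u 1) 0 (fin _ ltr01).
  by move=> y _; rewrite invr_gt0; have := u0 y; lra.
exists (Num.max 1 (m^-1 - 1)) => x; rewrite le_max; case: (leP (u x) 1) => //= ux.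
have := mh x ux; have u1 : 0 < u x + 1 by lra.
move=> mx; have : u x + 1 <= m^-1.
  by rewrite -[u x + 1]invrK lef_pV2 ?posrE ?invr_gt0.
lra.
Qed.

Lemma nth_largest_ge0 u V n : (forall x, 0 <= u x) -> 0 <= nth_largest V u n.
Proof.
move=> u0; rewrite /nth_largest; set S := (X in sup X).
have S0 : lbound S 0.
  move=> _ [ O [OV On] <-]; have [->|/set0P[y Oy]] := eqVneq O set0.
    by rewrite image_set0 inf0.
  by apply: lb_le_inf; [exists (u y), y|move=> _ [z _ <-]].
have [hs|hs] := pselect (has_sup S); last by rewrite sup_out.
case: hs => -[r Sr] ub; apply: (le_trans (S0 r Sr)); exact: ub_le_sup.
Qed.

(** Since [u] tends to zero it is bounded, so the supremum is genuine, and a minimum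
    over a finite set is attained. *)
Lemma nth_largest_gt u V n s : vanishing u -> (0 < n)%N -> 0 <= s ->
  s < nth_largest V u n <->
  exists O, [/\ O `<=` V, (O #= `I_n)%card & forall y, O y -> s < u y].
Proof.
move=> uv n0 s0; have [u0 _] := uv; rewrite /nth_largest; set S := (X in sup X).
have lb O : has_lbound (u @` O) by exists 0 => _ [y _ <-].
split=> [sS|[ O [OV On sO]]].
  have Sne : S !=set0.
    apply/set0P/eqP => e; move: sS; rewrite e sup0; lra.
  have [_ [ O [OV On] <-] sO] := sup_gt Sne sS.
  exists O; split=> // y Oy; apply: (lt_le_trans sO).
  by apply: ge_inf => //; exists y.
have finO : finite_set O by apply/finite_setP; exists n.
have [m sm mh] := finite_lower_bound finO sO.
have [y Oy] : O !=set0.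
  apply/set0P/eqP => e; have : (`I_n #<= `I_0)%card.
    by rewrite -(card_le_eql On) e; exact: card_ge0.
  by rewrite card_le_II leqNgt n0.
have [B uB] := vanishing_bounded uv.
apply: (lt_le_trans sm); apply: (@le_trans _ _ (inf (u @` O))).
  by apply: lb_le_inf; [exists (u y), y|move=> _ [z Oz <-]; exact: mh].
apply: ub_le_sup; last by exists O.
exists B => _ [ O' [_ O'n] <-].
have [->|/set0P[z Oz]] := eqVneq O' set0.
  by rewrite image_set0 inf0 (le_trans (u0 y)).
by apply: (le_trans _ (uB z)); apply: ge_inf => //; exists z.
Qed.

Lemma nth_largest_eq u V n r : vanishing u -> (0 < n)%N -> 0 <= r ->
  (forall s, 0 <= s -> s < r <->
     exists O, [/\ O `<=` V, (O #= `I_n)%card & forall y, O y -> s < u y]) ->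
  nth_largest V u n = r.
Proof.
move=> uv n0 r0 h; have [u0 _] := uv; apply/eqP; rewrite eq_le !leNgt.
apply/andP; split; apply/negP => lt.
  have := lt; rewrite (nth_largest_gt _ _ _ r0)// => /(h _ r0).
  by rewrite ltxx.
have g0 := nth_largest_ge0 V n u0.
by have /(h _ g0)/(nth_largest_gt _ uv n0 g0) := lt; rewrite ltxx.
Qed.
End NthLargest.

(** A sequence visiting every integer infinitely often, by decoding a 2-adic
    valuation. *)
Definition int_cycle (k : nat) : int := odflt 0 (choice.unpickle (logn 2 k.+1)).

Lemma int_cycle_recurs a K : exists2 k, (K <= k)%N & int_cycle k = a.
Proof.
set j := choice.pickle a; pose m := (2 ^ j * (2 * K).+1)%N.
have j0 : (0 < 2 ^ j)%N by rewrite expn_gt0.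
exists m.-1; first by rewrite /m; nia.
rewrite /int_cycle prednK; last by rewrite /m muln_gt0 j0.
rewrite /m lognM// pfactorK// logn_coprime ?addn0 ?choice.pickleK//.
by rewrite coprime2n /= mul2n odd_double.
Qed.

Section OneStep.
Variables (R : realType) (d : nat) (b : 'rV[int]_d) (c : int).
Hypothesis dir : lattice_direction b c.
Local Notation T := 'rV[int]_d.
Implicit Types (x y z : T) (u v : T -> R) (s t : R) (a k : int).
Local Notation height := (height b c).
Local Notation reflection := (reflection b c).
Local Notation better := (better b c).

Definition lattice_line x : set T := [set y | exists k : int, y = x + k *: b].

Lemma lattice_line_height_inj x y z : lattice_line x y -> lattice_line x z ->
  height y = height z -> y = z.
Proof.
move=> [k ->] [l ->]; rewrite !(heightDZ dir) => h.
by have -> : k = l by lia.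
Qed.

Lemma lattice_line_rank_inj x y z : lattice_line x y -> lattice_line x z ->
  rank (height y) = rank (height z) -> y = z.
Proof.
move=> oy oz r; apply: (lattice_line_height_inj oy oz); move: oy oz r.
move=> [k ->] [l ->]; rewrite !(heightDZ dir).
case: (rankP (height x + 2 * k)) => -[? ?];
case: (rankP (height x + 2 * l)) => -[? ?]; lia.
Qed.

(** On a line the rank is a bijection onto the positive integers: [n] and [1 - n] have
    opposite parities, and the heights on a line have a fixed parity. *)
Lemma card_rank_le x n :
  ([set y | lattice_line x y /\ (rank (height y) <= n)%N] #= `I_n)%card.
Proof.
apply/card_set_bijP; exists (fun y => (rank (height y)).-1); split.
- by move=> y [_] /=; have := rank_gt0 (height y); lia.
- move=> y z /set_mem[oy _] /set_mem[oz _] h; apply: (lattice_line_rank_inj oy oz).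
  by have := rank_gt0 (height y); have := rank_gt0 (height z); lia.
- move=> i /= ni.
  have [k hk] := rank_reach (height x) i.
  exists (x + k *: b); last by rewrite (heightDZ dir) hk.
  by split; [exists k|rewrite /= (heightDZ dir) hk].
Qed.

Lemma lattice_line_reflection a x y : lattice_line x y -> lattice_line x (reflection a y).
Proof. by move=> [k ->]; exists (k + (a - height (x + k *: b))); rewrite scalerDl addrA. Qed.

Fixpoint polarizations u (k : nat) : T -> R :=
  if k is k'.+1 then polarization b c (int_cycle k') (polarizations u k') else u.

Lemma polarizations_card u x t (k : nat) :
  (superlevel (polarizations u k) t `&` lattice_line x #=
   superlevel u t `&` lattice_line x)%card.
Proof.
elim: k => [|k IH]; first exact: card_eqxx.
apply: card_eq_trans IH; set w := polarizations u k; set a := int_cycle k.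
have swK := swapK dir a w.
have sworb y : lattice_line x y -> lattice_line x (swap b c a w y).
  by rewrite /swap; case: ifP => // _; exact: lattice_line_reflection.
have -> : superlevel (polarization b c a w) t `&` lattice_line x =
    swap b c a w @` (superlevel w t `&` lattice_line x).
  apply/seteqP; split=> y /=; rewrite /superlevel /polarization /=.
    by move=> [yt oy]; exists (swap b c a w y); rewrite ?swK//; split=> //; exact: sworb.
  by move=> [z [zt oz] <-]; rewrite swK; split=> //; exact: sworb.
by apply: inj_card_eq => y z _ _; exact: (can_inj swK).
Qed.

(** Every mirror of the direction is used infinitely often, so a limit violating the
    order of ranks across some mirror would be changed by the next use of that mirror,
    after the sequence has settled. *)
Lemma polarizations_limit (p : R) u : 1 <= p -> vanishing u ->
  exists v, [/\ improves p u v,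
    forall x k, (rank (height x) < rank (height (x + k *: b)))%N -> v (x + k *: b) <= v x &
    forall x t, 0 < t ->
      (superlevel v t `&` lattice_line x #= superlevel u t `&` lattice_line x)%card].
Proof.
move=> p1 uv.
have vk (k : nat) : vanishing (polarizations u k).
  elim: k => [//|k IH].
  exact: improves_vanishing (improves_polarization p1 (int_cycle k) dir IH).
have wS (k : nat) : improves p (polarizations u k) (polarizations u k.+1).
  exact: improves_polarization.
have [v wv imp] := improves_limit p1 (w := polarizations u) uv wS.
have [v0 vfin] := improves_vanishing (imp 0%N).
exists v; split; first exact: imp 0%N.
- move=> x k rk; rewrite leNgt; apply/negP => lt.
  set y := x + k *: b in rk lt *.
  (* The mirror exchanging [x] and [y]. *)
  pose a := height x + k.
  have ya : y = reflection a x by rewrite /y /reflection /a addrAC subrr add0r.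
  have bx : better a x by rewrite /better -ya.
  pose t := (v x + v y) / 2.
  have xt : v x < t by rewrite /t; lra.
  have t0 : 0 < t by exact: le_lt_trans xt.
  have ty : t < v y by rewrite /t; lra.
  have [K hK] := wv _ t0; have [l Kl la] := int_cycle_recurs a K.
  have wy : t < polarizations u l y by rewrite (max_eq_lt (hK l Kl y)).
  have := max_eq_lt (hK l.+1 (leqW Kl) x).
  rewrite [RHS]ltNge (ltW xt) /= la => /negP; apply.
  apply: (lt_le_trans wy); rewrite ya; exact: polarization_better.
- move=> x t t0; have [K hK] := wv _ t0.
  have -> : superlevel v t = superlevel (polarizations u K) t.
    apply/seteqP; split=> y; rewrite /superlevel /=;
    by rewrite (max_eq_lt (hK K (leqnn K) y)).
  exact: polarizations_card.
Qed.

(** A superlevel set of [v] is an initial segment of the line in the order of ranks,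
    and has as many points as that of [u]; so it contains [x] exactly when at least
    [rank (height x)] values of [u] on the line exceed the level. *)
Lemma nth_largest_lattice_line u v x : vanishing u -> vanishing v ->
  (forall y k, (rank (height y) < rank (height (y + k *: b)))%N -> v (y + k *: b) <= v y) ->
  (forall t, 0 < t ->
     (superlevel v t `&` lattice_line x #= superlevel u t `&` lattice_line x)%card) ->
  nth_largest (lattice_line x) u (rank (height x)) = v x.
Proof.
move=> uv vv mono card; have [v0 _] := vv; have [u0 _] := uv.
have mono' y z : lattice_line x y -> lattice_line x z ->
    (rank (height y) < rank (height z))%N -> v z <= v y.
  move=> [k ->] [l ->].
  have -> : x + l *: b = (x + k *: b) + (l - k) *: b.
    by rewrite -addrA -scalerDl addrCA subrr addr0.
  exact: mono.
have oxx : lattice_line x x by exists 0; rewrite scale0r addr0.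
apply: nth_largest_eq => //; first exact: rank_gt0.
move=> s s0; split=> [sv|[ O [OV On sO]]].
  pose t := (s + v x) / 2; have t0 : 0 < t by rewrite /t; lra.
  have tv : t < v x by rewrite /t; lra.
  have : (`I_(rank (height x)) #<= superlevel u t `&` lattice_line x)%card.
    rewrite -(card_le_eqr (card t t0)) -(card_le_eql (card_rank_le x _)).
    apply: subset_card_le => y [oy ry]; split=> //; rewrite /superlevel /=.
    move: ry; rewrite leq_eqVlt => /predU1P[ry|ry].
      by rewrite (lattice_line_rank_inj oy oxx ry).
    exact: lt_le_trans (mono' _ _ oy oxx ry).
  move=> /card_ge_subset[ O Osub On]; exists O; split=> //; first by move=> y /Osub[].
  by move=> y /Osub[yt _]; apply: lt_trans yt; rewrite /t; lra.
rewrite ltNge; apply/negP => vs.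
have [|m sm mO] := finite_lower_bound _ sO.
  by apply/finite_setP; exists (rank (height x)).
pose t := (s + m) / 2; have t0 : 0 < t by rewrite /t; lra.
(* All the points of the line where [v] exceeds [t] precede [x], but there are at
   least as many as the rank of [x]. *)
have : (`I_(rank (height x)) #<= `I_(rank (height x)).-1)%card.
  rewrite -(card_le_eql On) -(card_le_eqr (card_rank_le x _)).
  apply: (@card_le_trans _ _ _ (superlevel u t `&` lattice_line x)).
    apply: subset_card_le => y Oy; split; last exact: OV.
    by rewrite /superlevel /=; have := mO _ Oy; rewrite /t; lra.
  rewrite -(card_le_eql (card t t0)); apply: subset_card_le => y [yt oy].
  split=> //; have := rank_gt0 (height x).
  suff : (rank (height y) < rank (height x))%N by lia.
  rewrite ltnNge; apply/negP; rewrite leq_eqVlt => /predU1P[rx|rx].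
    move: yt; rewrite /superlevel /= -(lattice_line_rank_inj oxx oy rx) /t; lra.
  by have := mono' _ _ oxx oy rx; move: yt; rewrite /superlevel /= /t; lra.
by rewrite card_le_II; have := rank_gt0 (height x); lia.
Qed.

End OneStep.

Section RearrangementStep.
Variables (R : realType) (d : nat) (p : R).
Hypothesis p1 : 1 <= p.
Local Notation T := 'rV[int]_d.
Implicit Types (x y z b : T) (u v : T -> R) (s t : R) (a k c : int).

(** In an axis direction [c = 2] and [e] is [b]; in a diagonal one [c = 1] and [e] is
    half of [b]. *)
Definition spans b c (e : 'rV[rat]_d) : Prop :=
  e = (c%:~R / 2) *: map_mx intr b.

Lemma line_lattice_line b c e x : lattice_direction b c -> spans b c e ->
  line e x = lattice_line b x.
Proof.
move=> dir ->; have c0 : (c%:~R : rat) != 0.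
  by rewrite intr_eq0 gt_eqF// (coef_gt0 dir).
apply/seteqP; split=> y /=.
  move=> [q qE]; have [i bi] := entry1 dir.
  have qk : q * (c%:~R / 2) = ((x - y) 0 i)%:~R.
    by move/rowP: qE => /(_ i); rewrite !mxE bi mulr1 => ->.
  exists (- (x - y) 0 i); rewrite scaleNr.
  apply/rowP => j; move/rowP: qE => /(_ j); rewrite scalerA qk !mxE -rmorphM/=.
  by move=> /intr_inj; lia.
move=> [k ->]; exists (- k%:~R / (c%:~R / 2)).
rewrite scalerA divfK; last by rewrite mulf_neq0// invr_eq0.
apply/rowP => j; rewrite !mxE opprD addrA subrr add0r rmorphN rmorphM /=.
by rewrite mulNr.
Qed.

Lemma inner_height b c e x : spans b c e ->
  inner e x = (height b c x)%:~R / 2.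
Proof.
move=> ->; rewrite /inner /height /dot rmorphM/= rmorph_sum/=.
rewrite mulrAC mulr_sumr; apply: eq_bigr => i _.
by rewrite !mxE rmorphM/= mulrA.
Qed.

Lemma nth_largest_image (T' : choiceType) (V : set T) (f : T -> T') dflt u n :
  {in V &, injective f} ->
  nth_largest (f @` V) (u \o 'pinv_dflt V f) n = nth_largest V u n.
Proof.
move=> finj; set g := 'pinv_dflt V f.
have gf y : V y -> g (f y) = y by move=> Vy; apply: pinvKV => //; exact: mem_set.
congr sup; apply/seteqP; split=> r /=.
  move=> [A [AV An] <-]; exists (g @` A); last by rewrite -image_comp.
  split.
    by move=> _ [a /AV[y Vy <-] <-]; rewrite gf.
  apply: card_eq_trans An; apply: inj_card_eq => a1 a2.
  move=> /set_mem/AV[y Vy <-] /set_mem/AV[z Vz <-]; rewrite !gf// => -> //.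
move=> [A [AV An] <-]; exists (f @` A).
  split; first exact: image_subset.
  apply: card_eq_trans An; apply: inj_card_eq => y z.
  by move=> /set_mem/AV Vy /set_mem/AV Vz; apply: finj; exact: mem_set.
congr inf; rewrite image_comp; apply: eq_imagel => y /AV Vy /=.
by rewrite gf.
Qed.

(** The index used by the one-dimensional rearrangement at the coordinate [z / 2]. *)
Lemma rank_truncn (z : int) : (if (z%:~R / 2 : rat) <= 0 then
  Num.truncn (1 - 2 * (z%:~R / 2) : rat) else Num.truncn (2 * (z%:~R / 2) : rat))
  = rank z.
Proof.
have tr (n : nat) (q : rat) : q = n%:R -> Num.truncn q = n.
  by move=> ->; apply: truncn_def; rewrite lexx ltr_nat/=.
rewrite mulrCA divff// mulr1 pmulr_lle0// lerz0 /rank; case: ifP => z0; apply: tr.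
  have <- : (1 - z)%:~R = 1 - z%:~R :> rat by rewrite rmorphB.
  have e : 1 - z = `|1 - z|%N%:Z by lia.
  by rewrite [in LHS]e.
have e : z = `|z|%N%:Z by lia.
by rewrite [in LHS]e.
Qed.

(** By uniqueness of the nonincreasing arrangement of the values on each line, the
    one-step rearrangement is the limit of cyclic polarizations. *)
Lemma Rstep_improves b c e u : lattice_direction b c -> spans b c e ->
  vanishing u -> improves p u (Rstep e u) /\
  forall x k, (rank (height b c x) < rank (height b c (x + k *: b)))%N ->
    Rstep e u (x + k *: b) <= Rstep e u x.
Proof.
move=> dir eE uv; have [v [imp mono card]] := polarizations_limit dir p1 uv.
suff -> : Rstep e u = v by [].
apply/funext => x; rewrite /Rstep /RZ (line_lattice_line x dir eE) (inner_height x eE).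
rewrite rank_truncn nth_largest_image.
  apply: (nth_largest_lattice_line dir) => //; first exact: improves_vanishing imp.
  by move=> t; exact: card.
move=> y z /set_mem oy /set_mem oz; rewrite !(inner_height _ eE) => h.
apply: (lattice_line_height_inj dir oy oz); apply: (@intr_inj rat).
by apply: (divIf _ h).
Qed.

Lemma Edir_direction e : Edir e ->
  exists b c, lattice_direction b c /\ spans b c e.
Proof.
have mapu i : map_mx intr (unitv i) = delta_mx 0 i :> 'rV[rat]_d.
  by rewrite /unitv map_delta_mx.
case=> [[i ->]|[i [j [ij [->|->]]]]].
- exists (unitv i), 2; split; first exact: lattice_direction_axis.
  by rewrite /spans mapu divff// scale1r.
- exists (unitv i + unitv j), 1; split; first exact: lattice_direction_plus.
  by rewrite /spans map_mxD !mapu div1r.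
- exists (unitv i - unitv j), 1; split; first exact: lattice_direction_minus.
  by rewrite /spans map_mxB !mapu div1r.
Qed.

End RearrangementStep.

(** * Positivity of the Schwarz rearrangement *)

Section DownwardClosed.
Variable d : nat.
Local Notation T := 'rV[int]_d.
Implicit Types (x y z b : T) (i j : 'I_d) (a k c : int).
Variable S : set T.
Hypothesis Sdown : forall b c e, lattice_direction b c -> Edir e -> spans b c e ->
  forall x k, (rank (height b c x + 2 * k) < rank (height b c x))%N ->
  S x -> S (x + k *: b).

Lemma box_finite (N : nat) : finite_set [set x : T | forall i, `|x 0 i| <= N%:Z].
Proof.
pose f (g : {ffun 'I_d -> 'I_(2 * N).+1}) : T := \row_i ((g i)%:Z - N%:Z).
apply: (@sub_finite_set _ _ (f @` setT)); last exact: finite_image.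
move=> x /= xN; exists [ffun i : 'I_d => inord (absz (x 0 i + N%:Z))] => //.
by apply/rowP => i; rewrite mxE ffunE inordK; have := xN i; lia.
Qed.

(** Heights of equal parity are compared by absolute value, the positive one first. *)
Lemma rank_lt (n k : int) : `|n + 2 * k| < `|n| \/ (n < 0 /\ n + 2 * k = - n) ->
  (rank (n + 2 * k) < rank n)%N.
Proof.
by case: (rankP (n + 2 * k)) => -[? ?]; case: (rankP n) => -[? ?]; lia.
Qed.

Lemma down_axis i x k : `|x 0 i + k| < `|x 0 i| \/ (x 0 i < 0 /\ x 0 i + k = - x 0 i) ->
  S x -> S (x + k *: unitv i).
Proof.
move=> h; apply: (Sdown (lattice_direction_axis i) (e := delta_mx 0 i)).
- by left; exists i.
- by rewrite /spans /unitv map_delta_mx divff// scale1r.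
- by rewrite /height dotC dot_unitv; apply: rank_lt; lia.
Qed.

Lemma down_plus i j x k : i != j -> `|x 0 i + x 0 j + 2 * k| < `|x 0 i + x 0 j| ->
  S x -> S (x + k *: (unitv i + unitv j)).
Proof.
wlog ij : i j / (i < j)%N => [H|] ne h.
  case: (ltngtP i j) ne => [ij _|ji _|/ord_inj->]; last by rewrite eqxx.
    by apply: H => //; rewrite neq_ltn ij.
  rewrite [unitv i + _]addrC; apply: H => //; first by rewrite neq_ltn ji.
  by move: h; rewrite [x 0 i + _]addrC.
apply: (Sdown (lattice_direction_plus ij)
  (e := 2^-1 *: (delta_mx 0 i + delta_mx 0 j))).
- by right; exists i, j; split=> //; left.
- by rewrite /spans map_mxD /unitv !map_delta_mx div1r.
- by rewrite /height mul1r dotC dotDr !dot_unitv; apply: rank_lt; left.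
Qed.

Lemma down_minus i j x k : i != j -> `|x 0 i - x 0 j + 2 * k| < `|x 0 i - x 0 j| ->
  S x -> S (x + k *: (unitv i - unitv j)).
Proof.
wlog ij : i j k / (i < j)%N => [H|] ne h.
  case: (ltngtP i j) ne => [ij _|ji _|/ord_inj->]; last by rewrite eqxx.
    by apply: H => //; rewrite neq_ltn ij.
  rewrite -[unitv i - _]opprB scalerN -scaleNr.
  by apply: H => //; [rewrite neq_ltn ji|lia].
apply: (Sdown (lattice_direction_minus ij)
  (e := 2^-1 *: (delta_mx 0 i - delta_mx 0 j))).
- by right; exists i, j; split=> //; right.
- by rewrite /spans map_mxB /unitv !map_delta_mx div1r.
- by rewrite /height mul1r dotC dotDr dotNr !dot_unitv; apply: rank_lt; left.
Qed.

(** The set contains points with an arbitrarily large coordinate [y 0 i]. Diagonal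
    moves spend this coordinate to give each of the others the value it has in [z],
    and an axis move finally corrects the coordinate [i] itself. *)
Lemma down_closed_full : infinite_set S -> forall z, S z.
Proof.
move=> Sinf z.
pose M : int := 1 + \sum_i `|z 0 i|.
have zM i : `|z 0 i| < M.
  rewrite /M (bigD1 i)//=; set q := (X in _ < 1 + (_ + X)).
  have : 0 <= q by apply: sumr_ge0 => j _; exact: normr_ge0.
  lia.
(* Each of the at most [d] diagonal moves costs at most [2 * M], and the coordinate
   [i] must keep dominating all the others until the end. *)
pose N : int := 8 * M + 2 * M * d%:Z.
have M0 : 0 < M by rewrite ltr_pwDl// sumr_ge0.
have [y Sy [i yi]] : exists2 y, S y & exists i, N <= `|y 0 i|.
  apply: contrapT => h; apply: Sinf.
  apply: sub_finite_set (box_finite `|N|%N) => y Sy i /=.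
  rewrite leNgt; apply/negP => lt; apply: h; exists y => //; exists i.
  by rewrite /N in lt *; lia.
have {y Sy yi} [y Sy yi] : exists2 y, S y & N <= y 0 i.
  have [y0|y0] := leP 0 (y 0 i); first by exists y; rewrite // -(ger0_norm y0).
  exists (y + (- (2 * y 0 i)) *: unitv i); first by apply: down_axis => //; right; lia.
  by rewrite !mxE !eqxx /= mulr1; clearbody N; lia.
have key (r : seq 'I_d) : (size r <= d)%N -> exists2 y, S y &
    8 * M + 2 * M * (d - size r)%N%:Z <= y 0 i /\
    (forall j, j \in r -> j != i -> y 0 j = z 0 j).
  elim: r => [|j r IH] sr; first by exists y => //; split=> //; rewrite subn0.
  have {y Sy yi IH} [y Sy [yi yr]] := IH (ltnW sr).
  have step : 2 * M * (d - size (j :: r))%N%:Z + 2 * M <= 2 * M * (d - size r)%N%:Z.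
    rewrite /= in sr *; have -> : (d - size r)%N = (d - (size r).+1).+1 by lia.
    by rewrite [in leRHS]intS; lia.
  have nn : 0 <= 2 * M * (d - size (j :: r))%N%:Z by rewrite !mulr_ge0//; lia.
  have [ji|ji] := eqVneq j i.
    exists y => //; split; first by lia.
    move=> l; rewrite inE => /predU1P[->|lr li]; first by rewrite ji eqxx.
    exact: yr.
  have upd y' : S y' -> y 0 i - 2 * M <= y' 0 i -> y' 0 j = z 0 j ->
      (forall l, l != i -> l != j -> y' 0 l = y 0 l) ->
    exists2 y, S y & 8 * M + 2 * M * (d - size (j :: r))%N%:Z <= y 0 i /\
      (forall l, l \in j :: r -> l != i -> y 0 l = z 0 l).
    move=> Sy' y'i y'j y'l; exists y' => //; split; first by lia.
    move=> l; rewrite inE; have [->//|lj /= lr li] := eqVneq l j.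
    by rewrite y'l// yr.
  pose k := z 0 j - y 0 j.
  have ij : (i == j) = false by rewrite eq_sym (negbTE ji).
  have [zy|yz] := ltP `|z 0 j| `|y 0 j|.
    apply: (upd (y + k *: unitv j)).
    - by apply: down_axis => //; left; rewrite /k; lia.
    - by rewrite !mxE [i == j]ij andbF mulr0 addr0 gerBl; lia.
    - by rewrite !mxE !eqxx /= /k; lia.
    - by move=> l li lj; rewrite !mxE (negbTE lj) andbF mulr0 addr0.
  have zMj := zM j.
  have [k0|k0] := leP 0 k.
    apply: (upd (y + (- k) *: (unitv i - unitv j))).
    - have [k00|kn0] := eqVneq k 0; first by rewrite k00 oppr0 scale0r addr0.
      by apply: down_minus => //; rewrite ?ij// /k in k0 kn0 *; lia.
    - by rewrite !mxE !eqxx ij /= /k; lia.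
    - by rewrite !mxE !eqxx (negbTE ji) /= /k; lia.
    - by move=> l li lj; rewrite !mxE (negbTE lj) (negbTE li) !andbF subrr mulr0 addr0.
  apply: (upd (y + k *: (unitv i + unitv j))).
  - by apply: down_plus => //; rewrite ?ij// /k in k0 *; lia.
  - by rewrite !mxE !eqxx ij /= /k; lia.
  - by rewrite !mxE !eqxx (negbTE ji) /= /k; lia.
  - by move=> l li lj; rewrite !mxE (negbTE lj) (negbTE li) !andbF addr0 mulr0 addr0.
have [|{y Sy yi}y Sy [yi yz]] := key (enum 'I_d); first by rewrite size_enum_ord.
have -> : z = y + (z 0 i - y 0 i) *: unitv i.
  apply/rowP => j; rewrite !mxE eqxx /=; have [->|ji] := eqVneq j i; first by lia.
  by rewrite yz ?mem_enum//; lia.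
apply: down_axis => //; left; have := zM i.
have : 0 <= 2 * M * (d - size (enum 'I_d))%N%:Z by rewrite !mulr_ge0//; lia.
lia.
Qed.

End DownwardClosed.

(** * Strictly decreasing values *)

Section StrictRange.
Variables (R : realType) (d : nat) (u : 'rV[int]_d -> R).
Local Notation T := 'rV[int]_d.
Hypothesis uv : vanishing u.
Hypothesis ustrict : strict_range u.

Let level_card (O A : set T) m n : (O #= `I_m)%card -> (A #= `I_n)%card ->
  O `<=` A -> (m <= n)%N.
Proof.
by move=> Om An /subset_card_le; rewrite (card_le_eql Om) (card_le_eqr An) card_le_II.
Qed.

(** Two points sharing the value [u x] would give it two consecutive places in the
    list of largest values, right after the values above it. *)
Lemma strict_range_inj : inj_positive u.
Proof.
move=> x y ux0 uxy; apply: contrapT => xy; have [u0 fin] := uv.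
set A := superlevel u (u x).
have finA : finite_set A by exact: fin.
have [n An] := (finite_setP A).1 finA.
have := ustrict (ltn0Sn n); apply/negP; rewrite -leNgt; apply: (@le_trans _ _ (u x)).
  rewrite leNgt; apply/negP => /(nth_largest_gt setT uv (ltn0Sn n) (u0 x)).
  move=> [ O [_ On sO]].
  by have := level_card On An sO; rewrite ltnn.
have g0 := nth_largest_ge0 setT n.+2 u0.
rewrite leNgt; apply/negP => lt.
suff /(nth_largest_gt setT uv (ltn0Sn n.+1) g0) :
    exists O : set T, [/\ O `<=` setT, (O #= `I_n.+2)%card &
      forall z, O z -> nth_largest setT u n.+2 < u z] by rewrite ltxx.
exists [set` (x |` (y |` fset_set A))%fset]; split=> //.
  apply/card_eq_fsetP; rewrite !cardfsU1 (card_fset_set An) !inE.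
  rewrite !in_fset_set// !(@memNset _ A) ?(negbTE (introN eqP xy))//.
  - by rewrite /A /superlevel /= uxy ltxx.
  - by rewrite /A /superlevel /= ltxx.
move=> z /=; rewrite !inE => /or3P[/eqP->//|/eqP->|]; first by rewrite -uxy.
by rewrite in_fset_set// => /set_mem; apply: lt_trans.
Qed.

Lemma strict_range_infinite : infinite_set (superlevel u 0).
Proof.
move=> fin0; have [u0 fin] := uv.
have [n An] := (finite_setP _).1 fin0.
have := ustrict (ltn0Sn n).
move=> /(le_lt_trans (nth_largest_ge0 setT n.+2 u0)).
move=> /(nth_largest_gt setT uv (ltn0Sn n) (lexx 0)) [ O [_ On sO]].
by have := level_card On An sO; rewrite ltnn.
Qed.
End StrictRange.

(** * The Schwarz rearrangement and equality *)

Section SchwarzLimit.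
Variables (R : realType) (d : nat) (p : R) (s : seq 'rV[rat]_d) (u : 'rV[int]_d -> R).
Local Notation T := 'rV[int]_d.
Hypothesis d0 : (1 <= d)%N.
Hypothesis p1 : 1 <= p.
Hypothesis hs : enumerates_Edir s.
Hypothesis uv : vanishing u.

Lemma enumeration_Edir (e : 'rV[rat]_d) : e \in s <-> Edir e.
Proof. by have [_ <-] := hs. Qed.

Lemma enumeration_size_gt0 : (0 < size s)%N.
Proof.
have : Edir (delta_mx 0 (Ordinal d0) : 'rV[rat]_d) by left; eexists.
by move=> /enumeration_Edir; case: s.
Qed.

Lemma Riter_improves k : improves p (Riter s k u) (Riter s k.+1 u).
Proof.
have e_s (l : nat) : Edir (nth 0 s (l %% size s)).
  by apply/enumeration_Edir/mem_nth; rewrite ltn_mod enumeration_size_gt0.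
have step l : vanishing (Riter s l u) -> improves p (Riter s l u) (Riter s l.+1 u).
  move=> lv; have [b [c [dir eE]]] := Edir_direction (e_s l).
  by have [] := Rstep_improves p1 dir eE lv.
apply: (step k); elim: k => [//|k IH].
exact: improves_vanishing (step _ IH).
Qed.

(** The rearrangements settle, and each direction recurs infinitely often, so the limit
    is ordered by rank on the lines of every direction. *)
Lemma schwarz_limit :
  improves p u (schwarz s u) /\
  forall b c e, lattice_direction b c -> Edir e -> spans b c e ->
    forall x (k : int), (rank (height b c (x + k *: b)) < rank (height b c x))%N ->
    schwarz s u x <= schwarz s u (x + k *: b).
Proof.
have [v wv imp] := improves_limit p1 (w := fun k => Riter s k u) uv Riter_improves.
have vv := improves_vanishing (imp 0%N).
have wk k := improves_vanishing_seq (w := fun k => Riter s k u) uv Riter_improves k.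
have -> : schwarz s u = v.
  apply/funext => x; apply: (cvg_lim (@Rhausdorff R)).
  exact: (settles_cvg (x := x) wk vv wv).
split; first exact: imp 0%N.
move=> b c e dir es eE x k rk; rewrite leNgt; apply/negP => lt.
set y := x + k *: b in rk lt *.
have xE : x = y + (- k) *: b by rewrite /y scaleNr addrK.
pose t := (v x + v y) / 2.
have yt : v y < t by rewrite /t; lra.
have t0 : 0 < t by apply: le_lt_trans yt; case: vv.
have tx : t < v x by rewrite /t; lra.
have [K hK] := wv _ t0.
have /enumeration_Edir ein := es.
pose l := (index e s + K * size s)%N.
have Kl : (K <= l)%N.
  by rewrite (leq_trans _ (leq_addl _ _))// leq_pmulr// enumeration_size_gt0.
have le : nth 0 s (l %% size s) = e.
  by rewrite /l addnC modnMDl modn_small ?index_mem// nth_index.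
have [_ mono] := Rstep_improves p1 dir eE (wk l).
have := max_eq_lt (hK l.+1 (leqW Kl) y).
rewrite [RHS]ltNge (ltW yt) => /negP; apply.
have wx : t < Riter s l.+1 u x by rewrite (max_eq_lt (hK l.+1 (leqW Kl) x)).
apply: (lt_le_trans wx); rewrite /= le xE; apply: mono.
by rewrite -xE.
Qed.

(** The support of the limit is closed under the moves that lower the rank, and it is
    infinite because it carries the same positive values as [u]. *)
Lemma schwarz_gt0 : inj_positive u -> infinite_set (superlevel u 0) ->
  forall x, 0 < schwarz s u x.
Proof.
move=> uinj uinf; have [imp mono] := schwarz_limit.
apply: (@down_closed_full d (superlevel (schwarz s u) 0)).
  move=> b c e dir es eE x k rk; rewrite /superlevel /= => /lt_le_trans; apply.
  by apply: (mono _ _ _ dir es eE); rewrite (heightDZ dir).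
move=> fin; apply: uinf.
have E : u @` superlevel u 0 = schwarz s u @` superlevel (schwarz s u) 0.
  apply/seteqP; split=> r [x x0 <-].
    have [|y yx] := (improves_values imp x0).1; first by exists x.
    by exists y => //; rewrite /superlevel /= yx.
  have [|y yx] := (improves_values imp x0).2; first by exists x.
  by exists y => //; rewrite /superlevel /= yx.
have : finite_set (u @` superlevel u 0) by rewrite E; exact: finite_image.
rewrite (eq_finite_set (inj_card_eq _))//.
by move=> x y /set_mem x0 _; exact: uinj.
Qed.

(** Sending [x] to the point where [u] takes the value [v x] embeds the lattice into
    itself and reflects adjacency. As all vertices have the same finite degree, the
    image is closed under adjacency, hence it is everything by connectedness; in
    particular [u] has no zeros. *)
Lemma adj_values_iso v : (forall x, 0 < v x) -> inj_positive u -> inj_positive v ->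
  (forall r, 0 < r -> (exists x, u x = r) <-> (exists x, v x = r)) ->
  (forall r t, 0 < r -> 0 < t -> adj_values u r t <-> adj_values v r t) ->
  lattice_iso u v.
Proof.
move=> v0 uinj vinj val adjv.
have /choice[g gE] : forall x, exists y, u y = v x.
  by move=> x; apply/(val _ (v0 x)); exists x.
have ginj : injective g.
  by move=> x y gxy; apply: vinj => //; rewrite -!gE gxy.
have gadj x y : adj x y <-> adj (g x) (g y).
  have ug z : 0 < u (g z) by rewrite gE.
  split=> xy.
    have /(adjv _ _ (v0 x) (v0 y))[x' [y' [xy' ux uy]]] : adj_values v (v x) (v y).
      by exists x, y.
    rewrite (uinj (g x) x' (ug x)); last by rewrite gE ux.
    by rewrite (uinj (g y) y' (ug y)) ?gE ?uy.
  have /(adjv _ _ (v0 x) (v0 y))[x' [y' [xy' vx vy]]] : adj_values u (v x) (v y).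
    by exists (g x), (g y); rewrite !gE.
  by rewrite (vinj x x' (v0 x)) ?vx// (vinj y y' (v0 y)) ?vy.
have gsurj z : exists x, g x = z.
  apply: (@adj_connected _ (fun z => exists x, g x = z) (g 0)); first by exists 0.
  move=> _ y' [x <-] /adj_sym/nbrsP y'x.
  have sub : {subset [seq g y | y <- nbrs x] <= nbrs (g x)}.
    by move=> _ /mapP[y /nbrsP yx ->]; apply/nbrsP; exact: (gadj _ _).1.
  have gu : uniq [seq g y | y <- nbrs x] by rewrite map_inj_uniq ?nbrs_uniq.
  have [|_ eq] := uniq_min_size gu sub; first by rewrite size_map !size_nbrs.
  by move: y'x; rewrite -eq => /mapP[y _ ->]; exists y.
have /choice[h hE] := gsurj.
exists g; split=> //; exists h => x; last exact: hE.
by apply: ginj; rewrite hE.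
Qed.

End SchwarzLimit.

Lemma le_grad_norm (R : realType) (d : nat) (p : R) (u v : 'rV[int]_d -> R) :
  1 <= p -> (energy p v <= energy p u)%E -> (grad_norm p v <= grad_norm p u)%E.
Proof.
move=> p1 vu; rewrite !grad_normE; apply: gt0_ler_poweR.
- by rewrite invr_ge0; lra.
- by rewrite in_itv /= leey mule_ge0 ?energy_ge0// lee_fin.
- by rewrite in_itv /= leey mule_ge0 ?energy_ge0// lee_fin.
- by rewrite lee_pmul2l// lte_fin.
Qed.

Lemma grad_norm_inj (R : realType) (d : nat) (p : R) (u v : 'rV[int]_d -> R) :
  1 <= p -> grad_norm p v = grad_norm p u -> energy p v = energy p u.
Proof.
move=> p1 /(congr1 (fun r => poweR r p)); rewrite !grad_normE -!poweRrM.
have -> : p^-1 * p = 1 by rewrite mulVf// gt_eqF//; lra.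
rewrite !poweRe1 ?mule_ge0 ?energy_ge0 ?lee_fin//.
move=> h; apply/eqP; rewrite eq_le.
have half : (0 < (2^-1)%:E :> \bar R)%E by rewrite lte_fin.
have fin : (2^-1)%:E \is a @fin_num R by [].
by rewrite -(lee_pmul2l fin half) h lexx -(lee_pmul2l fin half) h lexx.
Qed.

Theorem theorem5p15 (R : realType) (d : nat) (hd : (1 <= d)%N)
    (s : seq 'rV[rat]_d) (hs : enumerates_Edir s)
    (p : R) (hp : 1 <= p) (u : 'rV[int]_d -> R)
    (hu : in_lp p u) (hu0 : forall x, 0 <= u x) :
  (grad_norm p (schwarz s u) <= grad_norm p u)%E /\
  (1 < p -> strict_range u ->
     (grad_norm p (schwarz s u) = grad_norm p u <-> lattice_iso u (schwarz s u))).
Proof.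
have uv : vanishing u by split=> // t; exact: lp_level_finite hp hu0 hu t.
have [imp _] := schwarz_limit hd hp hs uv.
split; first exact: le_grad_norm (improves_energy imp).
move=> pp ustrict; have fin := lp_energy_fin hp hu0 hu.
have uinj := strict_range_inj uv ustrict.
have uinf := strict_range_infinite uv ustrict.
split=> [/(grad_norm_inj hp) E|[g [gb ga gE]]].
  apply: adj_values_iso => //.
  - exact: schwarz_gt0 hd hp hs uv uinj uinf.
  - exact: improves_inj imp uinj.
  - exact: improves_values imp.
  - exact: improves_adj imp pp fin uinj E.
have -> : schwarz s u = u \o g by apply/funext => x; rewrite -gE.
by rewrite !grad_normE energy_automorphism.
Qed.
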